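(* Let $(M,g)$ be a complete Riemannian connected manifold, $m=\dim M$, and let $\sigma\colon(a,b)\to M$ be a smooth curve such that $j_{t_0}^{m-1}\sigma\in\mathcal{N}^{m-1}(M)$, $a<t_0<b$. If $X\in\mathfrak{i}(M,g)$ is a Killing vector field such that $X_{j_{t_0}^{m-1}\sigma}^{(m-1)}=0$, then $X=0$.
   Context: $\mathfrak{i}(M,g)$ is the Lie algebra of Killing vector fields of $(M,g)$. $J^r(\mathbb{R},M)$ is the bundle of $r$-jets of smooth curves in $M$. A diffeomorphism $\phi$ of $M$ acts on $J^r(\mathbb{R},M)$ by $\phi^{(r)}(j_t^r\sigma)=j_t^r(\phi\circ\sigma)$, and for $X\in\mathfrak{i}(M,g)$ with flow $\phi_\tau$, $X^{(r)}$ denotes the vector field on $J^r(\mathbb{R},M)$ generating the flow $\phi_\tau^{(r)}$. If $(x^1,\dots,x^m)$ is a normal coordinate system (for the Levi-Civita connection) centred at $\sigma(t_0)$, the tangent vectors $U_{t_0}^{\sigma,k}=\sum_i\frac{d^k(x^i\circ\sigma)}{dt^k}(t_0)\left.\frac{\partial}{\partial x^i}\right|_{\sigma(t_0)}$, $k\ge1$, do not depend on the normal coordinates chosen. $\mathcal{N}^{m-1}(M)\subset J^{m-1}(\mathbb{R},M)$ is the set of jets $j_{t_0}^{m-1}\sigma$ such that $U_{t_0}^{\sigma,1},\dots,U_{t_0}^{\sigma,m-1}$ are linearly independent (''normal general position up to the order $m-1$ at $t_0$''). *)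

(* Defs.v *)
From HB Require Import structures.
From mathcomp Require Import all_boot all_order all_algebra.
From mathcomp Require Import all_classical all_reals all_analysis.

Set Implicit Arguments.
Unset Strict Implicit.
Unset Printing Implicit Defensive.

Import Order.TTheory GRing.Theory Num.Theory.
Import numFieldNormedType.Exports.

Local Open Scope ring_scope.
Local Open Scope classical_set_scope.

(** Smooth maps.  All iterated directional derivatives exist and are
    continuous; the set A is always an open set of a finite-dimensional space,
    where this is the usual class C^k. *)

Fixpoint Ck (R : realType) (V W : normedModType R) (k : nat)
    (A : set V) (f : V -> W) : Prop :=
  {in A, continuous f} /\
  if k is k'.+1 then
    forall v, {in A, forall x, derivable f x v} /\ Ck k' A ('D_v f)
  else True.

Definition smooth (R : realType) (V W : normedModType R)
    (A : set V) (f : V -> W) := forall k, Ck k A f.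

(** Charts and manifolds.  A chart is a partial homeomorphism between
    [cdom c] and [ccod c] = [crd c (cdom c)], given by total functions whose
    values outside these sets are irrelevant.  Points of R^m are row vectors. *)

Record chart (R : realType) (m : nat) (T : topologicalType) := Chart {
  cdom : set T;
  crd : T -> 'rV[R]_m;
  cinv : 'rV[R]_m -> T
}.

Section Charts.
Context {R : realType} {m : nat} {T : topologicalType}.
Implicit Types c d : chart R m T.

Definition ccod c : set 'rV[R]_m := crd c @` cdom c.

Definition is_chart c :=
  [/\ open (cdom c), open (ccod c), {in cdom c, cancel (crd c) (cinv c)},
      {in cdom c, continuous (crd c)} & {in ccod c, continuous (cinv c)}].

Definition transition c d : 'rV[R]_m -> 'rV[R]_m := crd d \o cinv c.

Definition smooth_transition c d :=
  smooth (crd c @` (cdom c `&` cdom d)) (transition c d).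

End Charts.

(** The smooth structure is a maximal atlas, so that [atlas M c] means that c
    is a coordinate system of M. *)
Record manifold (R : realType) (m : nat) := Manifold {
  point_of :> topologicalType;
  atlas : set (chart R m point_of);
  manifold_hausdorff : hausdorff_space point_of;
  manifold_second_countable : @second_countable point_of;
  atlas_chart : forall c, atlas c -> is_chart c;
  atlas_cover : forall p, exists2 c, atlas c & cdom c p;
  atlas_smooth : forall c d, atlas c -> atlas d -> smooth_transition c d;
  atlas_max : forall c, is_chart c ->
    (forall d, atlas d -> smooth_transition c d /\ smooth_transition d c) ->
    atlas c
}.

Notation chart_of M := (chart _ _ (point_of M)).

(** Tensors are given by their components in every coordinate system, subject
    to the transformation law; ['D_u (transition c d) (crd c p)] is the image
    of u under the Jacobian matrix of the change of coordinates at p. *)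

Section Tensors.
Context {R : realType} {m : nat}.
Variable M : manifold R m.

Definition is_tangent (p : M) (u : chart_of M -> 'rV[R]_m) :=
  forall c d, atlas c -> atlas d -> cdom c p -> cdom d p ->
    u d = 'D_(u c) (transition c d) (crd c p).

Record vector_field := VectorField {
  vcomp :> chart_of M -> M -> 'rV[R]_m;
  vcomp_tangent : forall p, is_tangent p (vcomp^~ p);
  vcomp_smooth : forall c, atlas c -> smooth (ccod c) (vcomp c \o cinv c)
}.

Definition is_zero_field (X : vector_field) :=
  forall c p, atlas c -> cdom c p -> X c p = 0.

Definition bilin (G : 'M[R]_m) (u v : 'rV[R]_m) : R := (u *m G *m v^T) 0 0.

Record riemannian_metric := RiemannianMetric {
  gcomp :> chart_of M -> M -> 'M[R]_m;
  gcomp_sym : forall c p, atlas c -> cdom c p -> (gcomp c p)^T = gcomp c p;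
  gcomp_pos : forall c p, atlas c -> cdom c p ->
    forall u, u != 0 -> 0 < bilin (gcomp c p) u u;
  gcomp_tensor : forall c d p, atlas c -> atlas d -> cdom c p -> cdom d p ->
    forall u v, bilin (gcomp c p) u v =
      bilin (gcomp d p) ('D_u (transition c d) (crd c p))
                        ('D_v (transition c d) (crd c p));
  gcomp_smooth : forall c, atlas c -> smooth (ccod c) (gcomp c \o cinv c)
}.

End Tensors.

(** Smooth curves I -> M, I an open subset of R. *)
Definition smooth_curve (R : realType) (m : nat) (M : manifold R m)
    (I : set R) (s : R -> M) :=
  [/\ open I, {in I, continuous s} &
      forall c, atlas c -> smooth (I `&` s @^-1` cdom c) (crd c \o s)].

(** The k-th derivative at t of the coordinates of s in the system c. *)
Definition crd_derive (R : realType) (m : nat) (T : topologicalType)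
    (c : chart R m T) (s : R -> T) (k : nat) (t : R) : 'rV[R]_m :=
  derive1n k (crd c \o s) t.

Section Riemannian.
Context {R : realType} {m : nat} {M : manifold R m}.
Variable g : riemannian_metric M.

(** Christoffel symbols Gamma^k_ij of the Levi-Civita connection in the
    coordinate system c, at the point with coordinates x. *)
Definition christoffel (c : chart_of M) (x : 'rV[R]_m) (k i j : 'I_m) : R :=
  let G y := g c (cinv c y) in
  2^-1 * \sum_l invmx (G x) k l *
    ('D_('e_i) (fun y => G y j l) x + 'D_('e_j) (fun y => G y i l) x
     - 'D_('e_l) (fun y => G y i j) x).

Definition geodesic (I : set R) (s : R -> M) :=
  smooth_curve I s /\
  forall c t, atlas c -> I t -> cdom c (s t) -> forall k,
    crd_derive c s 2 t 0 k
    + \sum_i \sum_j christoffel c (crd c (s t)) k i j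
        * crd_derive c s 1 t 0 i * crd_derive c s 1 t 0 j = 0.

(** Every geodesic extends to all values of its affine parameter. *)
Definition complete_metric :=
  forall (I : set R) (s : R -> M), is_interval I -> I !=set0 -> geodesic I s ->
    exists2 s' : R -> M, geodesic setT s' & {in I, s =1 s'}.

(** exp_p(u) = q *)
Definition is_exp (p : M) (u : chart_of M -> 'rV[R]_m) (q : M) :=
  exists I s, [/\ is_interval I, I 0, I 1, geodesic I s &
    [/\ s 0 = p, s 1 = q &
        forall c, atlas c -> cdom c p -> crd_derive c s 1 0 = u c]].

Definition is_frame (p : M) (E : 'I_m -> chart_of M -> 'rV[R]_m) :=
  (forall i, is_tangent p (E i)) /\
  forall c, atlas c -> cdom c p -> \matrix_i E i c \in unitmx.

(** Normal coordinate systems centred at p: for some linear frame E at p, the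
    point with coordinates x is exp_p (x^1 E_1 + ... + x^m E_m). *)
Definition normal_chart (p : M) (c : chart_of M) :=
  [/\ atlas c, cdom c p, crd c p = 0 &
      exists2 E, is_frame p E &
        {in ccod c, forall x : 'rV[R]_m,
           is_exp p (fun d => \sum_i x 0 i *: E i d) (cinv c x)}].

(** Killing equation L_X g = 0 in coordinates. *)
Definition killing (X : vector_field M) :=
  forall c, atlas c -> {in ccod c, forall (x : 'rV[R]_m) (i j : 'I_m),
    let G y := g c (cinv c y) in
    let xi y := X c (cinv c y) in
    \sum_k (xi x 0 k * 'D_('e_k) (fun y => G y i j) x
            + G x k j * 'D_('e_i) (fun y => xi y 0 k) x
            + G x i k * 'D_('e_j) (fun y => xi y 0 k) x) = 0}.

End Riemannian.

(** The global flow of X, as a smooth action of R on M.  It is unique, and it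
    exists for every Killing vector field of a complete metric. *)
Definition is_flow (R : realType) (m : nat) (M : manifold R m)
    (X : vector_field M) (phi : R -> M -> M) :=
  [/\ forall p, phi 0 p = p,
      forall s t p, phi (s + t) p = phi s (phi t p),
      continuous (fun z : R * M => phi z.1 z.2),
      forall c d, atlas c -> atlas d ->
        smooth [set z : R * 'rV[R]_m |
                  ccod c z.2 /\ cdom d (phi z.1 (cinv c z.2))]
               (fun z : R * 'rV[R]_m => crd d (phi z.1 (cinv c z.2))) &
      forall c t p, atlas c -> cdom c (phi t p) ->
        is_derive t 1 (fun u => crd c (phi u p)) (X c (phi t p))].

Section Jets.
Context {R : realType} {m : nat} {M : manifold R m}.

Definition smooth_at (t : R) (s : R -> M) :=
  exists2 I : set R, I t & smooth_curve I s.

(** The jet j^r_t s, as the class of all (t, s') with s' smooth near t having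
    the same derivatives as s at t up to order r. *)
Definition jet (r : nat) (t : R) (s : R -> M) : set (R * (R -> M)) :=
  [set w | [/\ w.1 = t, smooth_at t w.2, w.2 t = s t &
     forall c k, atlas c -> cdom c (s t) -> (k <= r)%N ->
       crd_derive c w.2 k t = crd_derive c s k t]].

(** phi^(r) (j^r_t s) = j^r_t (phi \o s) *)
Definition jet_map (r : nat) (phi : M -> M) (j : set (R * (R -> M))) :
    set (R * (R -> M)) :=
  \bigcup_(w in j) jet r w.1 (phi \o w.2).

(** The coordinates of J^r(R, M) induced by c: the parameter t and the
    derivatives of order 0, ..., r (the rows of the matrix) of the coordinates.
    They take a single value on a jet based in [cdom c]. *)
Definition jet_crd (r : nat) (c : chart_of M) (j : set (R * (R -> M))) :
    R * 'M[R]_(r.+1, m) :=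
  get [set (w.1, \matrix_(k < r.+1) crd_derive c w.2 k w.1) | w in j].

(** The value at j of the infinitesimal generator of the flow (phi_tau)^(r),
    in the coordinates of J^r(R, M) induced by c. *)
Definition prolongation (r : nat) (phi : R -> M -> M) (c : chart_of M)
    (j : set (R * (R -> M))) : R * 'M[R]_(r.+1, m) :=
  derive1 (fun tau => jet_crd r c (jet_map r (phi tau) j)) 0.

(** Row k of the matrix consists of the components of U^{s,k+1}_t in the basis
    of coordinate vectors of the normal coordinate system c. *)
Definition normal_general_position (g : riemannian_metric M) (r : nat)
    (t : R) (s : R -> M) :=
  exists2 c, normal_chart g (s t) c &
    row_free (\matrix_(k < r) crd_derive c s k.+1 t).

(** The subset N^r(M) of J^r(R, M). *)
Definition normal_jets (g : riemannian_metric M) (r : nat) :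
    set (set (R * (R -> M))) :=
  [set j | exists t s,
     [/\ smooth_at t s, normal_general_position g r t s & j = jet r t s]].

End Jets.

(* Main.v *)
(** In normal coordinates at p = sigma(t0), geodesics through p are
    rays, i.e. the Christoffel symbols satisfy C_ijk(y) y^i y^j = 0.  Along a
    ray, a Killing field X with X(p) = 0 and the linear field y |-> y L with
    L = DX(0) both solve the Jacobi equation, with the same initial values;
    hence X is linear near p.  The prolongation of X vanishes at the jet of
    sigma iff the derivatives of t |-> X(sigma(t)) of order at most m - 1
    vanish at t0; as X is linear, this says X(p) = 0 and U^k L = 0 for
    1 <= k <= m - 1.  Thus L has rank at most 1, and by Killing's equation at
    p it is skew with respect to g, so L = 0 and X vanishes near p.  Finally,
    the second derivatives of a Killing field are linear functions of its
    1-jet, so the interior of its zero set is closed as well as open. *)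

From HB Require Import structures.
Require Import Defs.
From mathcomp Require Import all_boot all_order all_algebra.
From mathcomp Require Import all_classical all_reals all_analysis.
From mathcomp Require Import ring lra.
Import Order.TTheory GRing.Theory Num.Theory.
Import numFieldNormedType.Exports.
Local Open Scope ring_scope.
Local Open Scope classical_set_scope.
Set Implicit Arguments.
Unset Strict Implicit.
Unset Printing Implicit Defensive.

(** * Directional derivatives *)

Section DirectionalDerivatives.
Context {R : realType} {V W : normedModType R}.

(** All uniqueness for differential equations rests on one Gronwall lemma for finite families
    vanishing at the left endpoint: the 1-jet of X along a segment, X minus its linear model along a
    ray, the difference of two geodesics. The equations keep their index lowered, so the metric
    multiplies the unknown second derivative and the coefficients are plain derivatives of the
    metric; in the estimates, a local bound |w| <= K |w G(y)| stands for the inverse metric.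

    A normal chart provides, for each point, a geodesic of its own ending there at time 1. That the
    endpoints belonging to the points t x trace the geodesic of x takes rescaling and uniqueness of
    geodesics on all of [0, 1], across charts.

    The prolongation differentiates in tau the t-derivatives of phi_tau(sigma(t)). The two orders
    are exchanged by induction over finite sums of b_j(t) f_j(tau, u(t)), a class closed under d/dt;
    sums of the same kind show that the flow acts on jets. *)

Lemma is_derive1_comp (g : R -> W) (h : R -> R) (t dh : R) (dg : W) :
  is_derive (h t) 1 g dg -> is_derive t 1 h dh ->
  is_derive t 1 (g \o h) (dh *: dg).
Proof.
move=> [/derivable1_diffP dg' <-] [/derivable1_diffP dh' <-].
have dgh : differentiable (g \o h) t by exact: differentiable_comp.
split; first exact/derivable1_diffP.
rewrite deriveE// diff_comp//= (deriveE _ dg') (deriveE _ dh').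
by rewrite -[in LHS](mulr1 ('d h t 1)) [LHS]linearZ.
Qed.

(** The two difference quotients are the same function of [h]; only derivability along [v] enters,
    so this applies before differentiability is available. *)
Lemma is_derive_line (f : V -> W) (x v : V) (s : R) :
  derivable f (x + s *: v) v ->
  is_derive s 1 (fun r => f (x + r *: v)) ('D_v f (x + s *: v)).
Proof.
move=> df.
have E : (fun h : R => h^-1 *: (((fun r => f (x + r *: v)) \o shift s) (h *: 1) - f (x + s *: v))) =
  (fun h => h^-1 *: ((f \o shift (x + s *: v)) (h *: v) - f (x + s *: v))).
  apply/funext => h /=; congr (_ *: (f _ - _)).
  by rewrite [h%:A]mulr1 scalerDl addrCA.
by split; rewrite /derivable /derive E.
Qed.

Lemma is_derive_of_line (f : V -> W) (x v : V) (l : W) :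
  is_derive (0 : R) 1 (fun r => f (x + r *: v)) l -> is_derive x v f l.
Proof.
have E : (fun h : R => h^-1 *: (((fun r => f (x + r *: v)) \o shift 0) (h *: 1) - f (x + (0 : R) *: v))) =
  (fun h => h^-1 *: ((f \o shift x) (h *: v) - f x)).
  apply/funext => h /=.
  by rewrite [h%:A]mulr1 addr0 scale0r addr0 [x + _]addrC.
by move=> [+ <-]; rewrite /derivable /derive E => d; split.
Qed.

Lemma is_derive_scale (f : V -> W) (x v : V) (a : R) :
  derivable f x v -> is_derive x (a *: v) f (a *: 'D_v f x).
Proof.
move=> df; apply: is_derive_of_line.
have -> : (fun r => f (x + r *: (a *: v))) = (fun r => f (x + r *: v)) \o (fun r => a * r).
  by apply/funext => r /=; rewrite scalerA mulrC.
apply: is_derive1_comp.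
  by rewrite mulr0; have := @is_derive_line f x v 0; rewrite scale0r addr0; exact.
by apply: is_derive_eq; rewrite [X in X = _]mulr1.
Qed.

End DirectionalDerivatives.

Lemma mean_value_segment (R : realType) (V : normedModType R) (f : V -> R)
  (x v : V) :
  (forall s : R, 0 <= s <= 1 -> derivable f (x + s *: v) v) ->
  exists2 s : R, 0 <= s <= 1 & f (x + v) - f x = 'D_v f (x + s *: v).
Proof.
move=> df.
pose g (s : R) := f (x + s *: v).
have dg (s : R) : 0 <= s <= 1 -> is_derive s 1 g ('D_v f (x + s *: v)).
  by move=> /df; exact: is_derive_line.
have [||s /itvP s01] := @MVT_segment R g (fun s => 'D_v f (x + s *: v)) 0 1 ler01.
- by move=> s /itvP s01; apply: dg; rewrite !s01.
- apply: derivable_within_continuous => s; rewrite in_itv/= => /dg ds.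
  exact: ex_derive.
rewrite subr0 mulr1 /g scale1r scale0r addr0 => e.
by exists s => //; rewrite !s01.
Qed.

Lemma derive_coord (R : realType) (V : normedModType R) (p q : nat)
  (F : V -> 'M[R]_(p, q)) (x v : V) i j :
  derivable F x v -> is_derive x v (fun y => F y i j) ('D_v F x i j).
Proof.
move=> dF; split; first exact: (derivable_mxP F x v).1.
by rewrite derive_mx// mxE.
Qed.

(** * Maps of class C^k *)

Section Ck_theory.
Context {R : realType} {V W : normedModType R}.
Implicit Types (A B : set V) (f g : V -> W).

Lemma Ck_continuous k A f x : Ck k A f -> A x -> {for x, continuous f}.
Proof. by case: k => [|k] [cf _] Ax; apply: cf; rewrite inE. Qed.

Lemma Ck_derivable k A f x v : Ck k.+1 A f -> A x -> derivable f x v.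
Proof. by move=> [_ /(_ v)[df _]] Ax; apply: df; rewrite inE. Qed.

Lemma Ck_derive k A f v : Ck k.+1 A f -> Ck k A ('D_v f).
Proof. by move=> [_ /(_ v)[]]. Qed.

Lemma Ck_subset k A B f : A `<=` B -> Ck k B f -> Ck k A f.
Proof.
move=> AB; elim: k f => [|k IH] f [cf df]; split.
- by move=> x; rewrite inE => /AB Bx; apply: cf; rewrite inE.
- by [].
- by move=> x; rewrite inE => /AB Bx; apply: cf; rewrite inE.
move=> v; have [dv Dv] := df v; split; last exact: IH.
by move=> x; rewrite inE => /AB Bx; apply: dv; rewrite inE.
Qed.

Lemma Ck_pred k A f : Ck k.+1 A f -> Ck k A f.
Proof.
elim: k f => [|k IH] f [cf df]; split => //.
by move=> v; have [dv Dv] := df v; split => //; exact: IH.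
Qed.

(** Each clause of [Ck] concerns one point of [A] at a time. This serves curves in a manifold, which
    have a given coordinate expression only near each parameter value. *)
Lemma Ck_local k A f :
  (forall x, A x -> exists B, [/\ open B, B x & Ck k B f]) -> Ck k A f.
Proof.
elim: k f => [|k IH] f loc; split => //.
- by move=> x; rewrite inE => /loc[B [_ Bx]] /Ck_continuous; exact.
- by move=> x; rewrite inE => /loc[B [_ Bx]] /Ck_continuous; exact.
move=> v; split.
  by move=> x; rewrite inE => /loc[B [_ Bx]] /Ck_derivable; exact.
by apply: IH => x /loc[B [oB Bx /Ck_derive CB]]; exists B; split.
Qed.

(** Coordinate expressions mean nothing outside their domains, so functions are compared on [A]
    alone; as [A] is open, they agree near each of its points, and so do their derivatives. *)
Lemma Ck_eq k A f g : open A -> {in A, f =1 g} -> Ck k A f -> Ck k A g.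
Proof.
move=> oA; elim: k f g => [|k IH] f g fg Cf.
all: have near_fg x : A x -> \near x, f x = g x
  by move=> Ax; near=> y; apply: fg; rewrite inE; near: y; exact: open_nbhs_nbhs.
all: have cg : {in A, continuous g}
  by move=> x; rewrite inE => Ax; have := Ck_continuous Cf Ax;
     rewrite /continuous_at -(fg x) ?inE//; apply: cvg_trans;
     exact: near_eq_cvg (near_fg _ Ax).
  by [].
split; first exact: cg.
move=> v; split.
  move=> x; rewrite inE => Ax.
  by apply: (near_eq_derivable (near_fg _ Ax)); exact: Ck_derivable Cf Ax.
apply: IH (Ck_derive v Cf) => x; rewrite inE => Ax.
exact: near_eq_derive (near_fg _ Ax).
Unshelve. all: by end_near. Qed.

Lemma CkD k A f g : open A -> Ck k A f -> Ck k A g -> Ck k A (f \+ g).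
Proof.
move=> oA; elim: k f g => [|k IH] f g Cf Cg; split => //.
- move=> x; rewrite inE => Ax; apply: cvgD.
    exact: Ck_continuous Cf Ax.
  exact: Ck_continuous Cg Ax.
- move=> x; rewrite inE => Ax; apply: cvgD.
    exact: Ck_continuous Cf Ax.
  exact: Ck_continuous Cg Ax.
move=> v; split.
  move=> x; rewrite inE => Ax; apply: derivableD.
    exact: Ck_derivable Cf Ax.
  exact: Ck_derivable Cg Ax.
apply: Ck_eq (IH _ _ (Ck_derive v Cf) (Ck_derive v Cg)) => // x.
rewrite inE => Ax /=; rewrite deriveD//.
  exact: Ck_derivable Cf Ax.
exact: Ck_derivable Cg Ax.
Qed.

Lemma Ck_cst k A (w : W) : Ck k A (cst w).
Proof.
elim: k w => [|k IH] w; split => //.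
- by move=> x _; exact: cvg_cst.
- by move=> x _; exact: cvg_cst.
move=> v; split; first by move=> x _; exact: derivable_cst.
have -> : 'D_v (cst w) = cst (0 : W).
  by apply/funext => x; rewrite derive_cst.
exact: IH.
Qed.

Lemma Ck_sum k A (I : Type) (r : seq I) (F : I -> V -> W) : open A ->
  (forall i, Ck k A (F i)) -> Ck k A (fun x => \sum_(i <- r) F i x).
Proof.
move=> oA CF; elim: r => [|i r IH].
  by rewrite (_ : (fun _ => _) = cst 0); [exact: Ck_cst|apply/funext => x; rewrite big_nil].
rewrite (_ : (fun _ => _) = F i \+ (fun x => \sum_(i <- r) F i x)).
  exact: CkD.
by apply/funext => x; rewrite big_cons.
Qed.

End Ck_theory.

Lemma CkM (R : realType) (V : normedModType R) k (A : set V) (f g : V -> R) :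
  open A -> Ck k A f -> Ck k A g -> Ck k A (f \* g).
Proof.
move=> oA; elim: k f g => [|k IH] f g Cf Cg; split => //.
- move=> x; rewrite inE => Ax; apply: cvgM.
    exact: Ck_continuous Cf Ax.
  exact: Ck_continuous Cg Ax.
- move=> x; rewrite inE => Ax; apply: cvgM.
    exact: Ck_continuous Cf Ax.
  exact: Ck_continuous Cg Ax.
move=> v; split.
  move=> x; rewrite inE => Ax; apply: derivableM.
    exact: Ck_derivable Cf Ax.
  exact: Ck_derivable Cg Ax.
have /Ck_eq : Ck k A ((f \* 'D_v g) \+ (g \* 'D_v f)).
  apply: CkD => //; apply: IH; (try exact: Ck_pred); exact: Ck_derive.
apply => // x; rewrite inE => Ax /=; rewrite deriveM//.
  exact: Ck_derivable Cf Ax.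
exact: Ck_derivable Cg Ax.
Qed.

Lemma Ck_mxP (R : realType) (V : normedModType R) k (A : set V) (p q : nat)
  (F : V -> 'M[R]_(p, q)) : open A ->
  Ck k A F <-> forall i j, Ck k A (fun x => F x i j).
Proof.
move=> oA; split.
  elim: k F => [|k IH] F CF i j; split => //.
  - move=> x; rewrite inE => Ax.
    apply: (@continuous_comp _ _ _ F (fun M : 'M[R]_(p, q) => M i j)).
      exact: Ck_continuous CF Ax.
    exact: coord_continuous.
  - move=> x; rewrite inE => Ax.
    apply: (@continuous_comp _ _ _ F (fun M : 'M[R]_(p, q) => M i j)).
      exact: Ck_continuous CF Ax.
    exact: coord_continuous.
  move=> v; split.
    move=> x; rewrite inE => Ax; apply: ex_derive; apply: derive_coord.
    exact: Ck_derivable CF Ax.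
  apply: Ck_eq (IH _ (Ck_derive v CF) i j) => // x; rewrite inE => Ax.
  by have [_ ->] := derive_coord i j (Ck_derivable (v := v) CF Ax).
have ctsF (G : V -> 'M[R]_(p, q)) x :
  (forall i j, {for x, continuous (fun y => G y i j)}) -> {for x, continuous G}.
  move=> cG; apply/cvgrPdist_le => /= e e0; near=> y.
  rewrite /Num.Def.normr/= mx_normrE (bigmax_le _ (ltW e0))//= => i _.
  rewrite !mxE/=; move: i; near: y; apply: filter_forall => /= i.
  by have /cvgrPdist_le := cG i.1 i.2; apply.
elim: k F => [|k IH] F CF; split => //.
- move=> x; rewrite inE => Ax; apply: ctsF => i j.
  exact: Ck_continuous (CF i j) Ax.
- move=> x; rewrite inE => Ax; apply: ctsF => i j.
  exact: Ck_continuous (CF i j) Ax.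
move=> v.
have dF x : A x -> derivable F x v.
  by move=> Ax; apply/derivable_mxP => i j; exact: Ck_derivable (CF i j) Ax.
split; first by move=> x; rewrite inE; exact: dF.
apply: IH => i j; apply: Ck_eq (Ck_derive v (CF i j)) => // x; rewrite inE => Ax.
by have [_ ->] := derive_coord i j (dF _ Ax).
Unshelve. all: by end_near. Qed.

Section MatrixNorm.
Context {R : realType} {p q : nat}.
Implicit Types (M : 'M[R]_(p, q)) (e : R).

Lemma coord_le_norm M i j : `|M i j| <= `|M|.
Proof.
rewrite [leRHS]/Num.Def.normr/= mx_normrE.
exact: (le_bigmax _ (fun ij => `|M ij.1 ij.2|) (i, j)).
Qed.

Lemma norm_le_coord M e : 0 <= e -> (forall i j, `|M i j| <= e) -> `|M| <= e.
Proof.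
by move=> e0 Me; rewrite [leLHS]/Num.Def.normr/= mx_normrE (bigmax_le _ e0)/=.
Qed.

End MatrixNorm.

Lemma cvg_sumr (R : realType) (W : normedModType R) (T I : Type)
  (F : set_system T) {FF : Filter F} (r : seq I) (f : I -> T -> W) (a : I -> W) :
  (forall i, f i @ F --> a i) ->
  (fun x => \sum_(i <- r) f i x) @ F --> \sum_(i <- r) a i.
Proof. by move=> fa; apply: cvg_big => //; exact: add_continuous. Qed.

Lemma differentiable_linear_approx (R : realType) (V W : normedModType R)
  (f : V -> W) (df : {linear V -> W}) x : continuous df ->
  f \o shift x = cst (f x) + df +o_ 0 id -> differentiable f x.
Proof.
by move=> cdf Hd; apply/diff_locallyP; rewrite (diff_unique cdf Hd).
Qed.

(** * Differentiability of C^1 functions of several variables *)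

Section FiniteDimension.
Context {R : realType} {m : nat}.
Implicit Types (A : set 'rV[R]_m) (f : 'rV[R]_m -> R).

Definition dot_row (d : 'cV[R]_m) (h : 'rV[R]_m) : R := (h *m d) 0 0.

Lemma dot_row_is_linear d : linear (dot_row d).
Proof. by move=> a u v; rewrite /dot_row mulmxDl -scalemxAl !mxE. Qed.

HB.instance Definition _ d := GRing.isLinear.Build R 'rV[R]_m R *:%R (dot_row d)
  (dot_row_is_linear d).

Lemma dot_rowE d h : dot_row d h = \sum_i h 0 i * d i 0.
Proof. by rewrite /dot_row mxE. Qed.

Lemma dot_row_continuous d : continuous (dot_row d).
Proof.
move=> x; rewrite /continuous_at.
have -> : dot_row d = (fun h => \sum_i h 0 i * d i 0).
  by apply/funext => h; rewrite dot_rowE.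
apply: (cvg_sumr (F := nbhs x)) => i; apply: cvgMr_tmp; exact: coord_continuous.
Qed.

(** Partial sums of [h] in the standard basis: the path from [x] to [x + h] through the points
    [x + trunc_row h j] changes one coordinate per step. *)
Let trunc_row (h : 'rV[R]_m) (j : nat) : 'rV[R]_m :=
  \row_i (if (i < j)%N then h 0 i else 0).

Let trunc_rowS h (j : 'I_m) :
  trunc_row h j.+1 = trunc_row h j + h 0 j *: 'e_j.
Proof.
apply/rowP => i; rewrite !mxE eqxx/= ltnS leq_eqVlt.
have [->|ij] := eqVneq i j; first by rewrite eqxx ltnn mulr1 add0r.
by rewrite (negPf (ij : (i : nat) != j)) mulr0 addr0.
Qed.

(** [Ck] speaks of directional derivatives only. The increment of [f] telescopes over steps in one
    coordinate each, and the mean value theorem turns each step into a coordinate of [h] times a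
    partial derivative close to its value at [x]. *)
Lemma C1_differentiable A f x : open A -> Ck 1 A f -> A x -> differentiable f x.
Proof.
move=> oA Cf Ax.
pose d : 'cV[R]_m := \col_i 'D_('e_i) f x.
apply: (@differentiable_linear_approx _ _ _ f (dot_row d)).
  exact: dot_row_continuous.
apply/eqaddoP => _/posnumP[e].
(* Each of the [m] steps will cost at most [e / (m + 1) * |h|]; [m + 1] also keeps the quotient
   meaningful for [m = 0]. *)
have m1 : 0 < m.+1%:R :> R by rewrite ltr0n.
have em : 0 < e%:num / m.+1%:R by rewrite divr_gt0.
have : \near x, A x /\ forall i : 'I_m, `|'D_('e_i) f x - d i 0| <= e%:num / m.+1%:R.
  near=> y; split; first by near: y; exact: open_nbhs_nbhs.
  near: y; apply: filter_forall => i.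
  have /Ck_continuous : Ck 0 A ('D_('e_i) f) by exact: Ck_derive.
  move=> /(_ _ Ax)/cvgrPdist_le/(_ _ em).
  by apply: filterS => y; rewrite distrC mxE.
move=> /nbhs_ballP[r /= r0 Br].
near=> h.
have hr : `|h| < r.
  near: h; apply/nbhs_ballP; exists r => //= h.
  by rewrite -ball_normE/= sub0r normrN.
rewrite opprD -![(_ + _ : _ -> _) _]/(_ + _) -![(- _ : _ -> _) _]/(- _)/= addrA.
have tE : f (h + x) - f x = \sum_(j < m) (f (x + trunc_row h j.+1) - f (x + trunc_row h j)).
  rewrite -(big_mkord xpredT (fun j => f (x + trunc_row h j.+1) - f (x + trunc_row h j))).
  rewrite telescope_sumr// [x + trunc_row h 0%N](_ : _ = x); last first.
    by apply/rowP => i; rewrite !mxE addr0.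
  rewrite [trunc_row h m](_ : _ = h) 1?[x + h]addrC//.
  by apply/rowP => i; rewrite !mxE ltn_ord.
rewrite tE dot_rowE -sumrB.
have step (j : 'I_m) : `|f (x + trunc_row h j.+1) - f (x + trunc_row h j) - h 0 j * d j 0|
    <= e%:num / m.+1%:R * `|h|.
  (* In the maximum norm, truncating [h] and shrinking one of its coordinates cannot increase the
     norm, so the path stays in the ball. *)
  have inB (s : R) : 0 <= s <= 1 -> ball x r (x + trunc_row h j + s *: (h 0 j *: 'e_j)).
    move=> /andP[s0 s1]; rewrite -ball_normE/=.
    rewrite -addrA opprD addrA subrr add0r normrN (le_lt_trans _ hr)//.
    apply: norm_le_coord => // a i; rewrite !mxE ord1 eqxx/=.
    case: ltnP => [ij|ji].
      rewrite (_ : (i == j) = false) ?mulr0 ?addr0 ?coord_le_norm//.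
      by apply/eqP => ij'; rewrite ij' ltnn in ij.
    rewrite add0r; case: eqP => _; last by rewrite !mulr0 normr0.
    rewrite mulr1 normrM ger0_norm//.
    by rewrite (le_trans (ler_piMl _ s1))// coord_le_norm.
  have [|s s01] := @mean_value_segment R _ f (x + trunc_row h j) (h 0 j *: 'e_j).
    move=> s /inB/Br[Ay _].
    by apply: ex_derive; apply: is_derive_scale; exact: Ck_derivable Cf Ay.
  rewrite trunc_rowS addrA => ->.
  have [Ay dy] := Br _ (inB _ s01).
  have [_ ->] := @is_derive_scale R _ _ f _ 'e_j (h 0 j) (Ck_derivable Cf Ay).
  rewrite -mulrBr normrM mulrC ler_pM//.
  exact: coord_le_norm.
apply: (le_trans (ler_norm_sum _ _ _)).
apply: (le_trans (ler_sum _ (fun j _ => step j))).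
rewrite sumr_const card_ord -[leLHS]mulr_natr [leLHS]mulrAC ler_wpM2r//.
rewrite -mulrA ler_piMr// mulrC ler_pdivrMr// mul1r ler_nat; exact: leqnSn.
Unshelve. all: by end_near. Qed.

Lemma derive_sum_coord A f x v : open A -> Ck 1 A f -> A x ->
  'D_v f x = \sum_i v 0 i * 'D_('e_i) f x.
Proof.
move=> oA Cf Ax; have df := C1_differentiable oA Cf Ax.
rewrite deriveE// {1}(row_sum_delta v) linear_sum.
by apply: eq_bigr => i _; rewrite linearZ deriveE.
Qed.

Lemma is_derive_curve A f (u : R -> 'rV[R]_m) t u' : open A -> Ck 1 A f ->
  A (u t) -> is_derive t 1 u u' ->
  is_derive t 1 (f \o u) (\sum_i u' 0 i * 'D_('e_i) f (u t)).
Proof.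
move=> oA Cf Au [/derivable1_diffP du <-].
have df := C1_differentiable oA Cf Au.
have dfu : differentiable (f \o u) t by exact: differentiable_comp.
split; first exact/derivable1_diffP.
by rewrite deriveE// diff_comp//= -(derive_sum_coord _ oA Cf Au) deriveE// deriveE.
Qed.

End FiniteDimension.

(** * Symmetry of second derivatives *)

(** The points [y] and [z] may differ: mean value arguments do not control where the two sides are
    evaluated, and continuity absorbs the discrepancy. *)
Lemma eq_at_limit (R : realType) (V : normedModType R) (A : set V)
  (f g : V -> R) (x : V) : nbhs x A ->
  {for x, continuous f} -> {for x, continuous g} ->
  (forall r : R, 0 < r -> ball x r `<=` A ->
     exists2 y, ball x r y & exists2 z, ball x r z & f y = g z) ->
  f x = g x.
Proof.
move=> nA cf cg fg.
apply/eqP; rewrite -subr_eq0 -normr_le0; apply/ler_addgt0Pl => e e0.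
rewrite addr0; have e2 : 0 < e / 2 by rewrite divr_gt0.
move/cvgrPdist_le : cf => /(_ _ e2) nf.
move/cvgrPdist_le : cg => /(_ _ e2) ng.
have : \forall y \near x, A y /\ (`|f x - f y| <= e / 2 /\ `|g x - g y| <= e / 2).
  by apply: filterI => //; exact: filterI.
move=> /nbhs_ballP[r /= r0 Br].
have [|y yr [z zr E]] := fg _ r0; first by move=> y /Br[].
have [_ [b1 _]] := Br _ yr; have [_ [_ b2]] := Br _ zr.
rewrite -(subrKA (f y)) {2}E (le_trans (ler_normD _ _))// (splitr e) lerD//.
by rewrite distrC.
Qed.

Lemma derive_symmetric (R : realType) (V : normedModType R) (A : set V)
  (f : V -> R) (x u v : V) : open A -> Ck 2 A f -> A x ->
  'D_u ('D_v f) x = 'D_v ('D_u f) x.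
Proof.
move=> oA Cf Ax.
(* The second difference of f over a small parallelogram at x spanned by
   multiples of u and v equals both second derivatives at points near x. *)
have key (a b : V) (h : R) : (forall s r : R, 0 <= s <= 1 -> 0 <= r <= 1 ->
      A (x + s *: (h *: a) + r *: (h *: b))) ->
    exists s r : R, [/\ 0 <= s <= 1, 0 <= r <= 1 &
      f (x + h *: a + h *: b) - f (x + h *: a) - f (x + h *: b) + f x =
      h * h * 'D_b ('D_a f) (x + s *: (h *: a) + r *: (h *: b))].
  move=> hA.
  have i01 : 0 <= (0:R) <= 1 by rewrite lexx ler01.
  have i11 : 0 <= (1:R) <= 1 by rewrite lexx ler01.
  pose F y := f (y + h *: b) - f y.
  have dF s : 0 <= s <= 1 -> is_derive (x + s *: (h *: a)) (h *: a) F
      (h * ('D_a f (x + s *: (h *: a) + h *: b) - 'D_a f (x + s *: (h *: a)))).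
    move=> s01; rewrite mulrBr; apply: is_deriveB.
      have [|d e] := @is_derive_scale _ _ _ f (x + s *: (h *: a) + h *: b) a h.
        by apply: Ck_derivable Cf _; have := hA _ _ s01 i11; rewrite scale1r.
      rewrite -[X in is_derive _ _ _ X]e; apply: is_derive_of_line.
      rewrite (_ : (fun r => _) = fun r => f (x + s *: (h *: a) + h *: b + r *: (h *: a))); last first.
        by apply/funext => r; congr f; rewrite addrAC.
      have := @is_derive_line _ _ _ f (x + s *: (h *: a) + h *: b) (h *: a) 0.
      by rewrite scale0r addr0; exact.
    apply: is_derive_scale; apply: Ck_derivable Cf _.
    by have := hA _ _ s01 i01; rewrite scale0r addr0.
  have [s s01|s s01] := @mean_value_segment _ _ F x (h *: a).
    by apply: ex_derive; exact: dF.
  have [_ ->] := dF _ s01 => eF.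
  have [r r01|r r01] := @mean_value_segment _ _ ('D_a f) (x + s *: (h *: a)) (h *: b).
    apply: ex_derive; apply: is_derive_scale.
    exact: Ck_derivable (Ck_derive a Cf) (hA _ _ s01 r01).
  have [|_ ->] := @is_derive_scale _ _ _ ('D_a f) (x + s *: (h *: a) + r *: (h *: b)) b h.
    exact: Ck_derivable (Ck_derive a Cf) (hA _ _ s01 r01).
  move=> er; exists s, r; split => //.
  rewrite er in eF; rewrite -[RHS]mulrA -eF /F.
  by rewrite opprB addrA; ring.
have Cuv a b : {for x, continuous ('D_a ('D_b f))}.
  by apply: Ck_continuous Ax; do 2 apply: Ck_derive; exact: Cf.
have nA : nbhs x A by exact: open_nbhs_nbhs.
apply: (eq_at_limit nA (Cuv u v) (Cuv v u)) => r r0 Br.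
have n1 : 0 < `|u| + `|v| + 1 by rewrite ltr_wpDl// addr_ge0.
(* This scale keeps the parallelogram in the ball of radius [r]; the [+ 1] covers [u = v = 0]. *)
pose h := r / 2 / (`|u| + `|v| + 1).
have h0 : 0 < h by rewrite !divr_gt0.
have inB a b (s t : R) : `|a| + `|b| <= `|u| + `|v| -> 0 <= s <= 1 -> 0 <= t <= 1 ->
    ball x r (x + s *: (h *: a) + t *: (h *: b)).
  move=> ab /andP[s0 s1] /andP[t0 t1]; rewrite -ball_normE/=.
  rewrite -addrA opprD addrA subrr add0r normrN (le_lt_trans (ler_normD _ _))//.
  rewrite !normrZ !ger0_norm ?(ltW h0)//.
  apply: (@le_lt_trans _ _ (h * (`|u| + `|v|))).
    rewrite (le_trans _ (ler_wpM2l (ltW h0) ab))// mulrDr lerD//.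
      by rewrite ler_piMl// mulr_ge0// ltW.
    by rewrite ler_piMl// mulr_ge0// ltW.
  rewrite /h mulrAC ltr_pdivrMr// (@le_lt_trans _ _ (r / 2 * (`|u| + `|v| + 1)))//.
  - by rewrite ler_wpM2l ?lerDl// divr_ge0// ltW.
  - by rewrite ltr_pM2r// ltr_pdivrMr// ltr_pMr// ltr1n.
  - exact: ltW.
have vu : `|v| + `|u| <= `|u| + `|v| by rewrite addrC.
have hyp1 : forall s t : R, 0 <= s <= 1 -> 0 <= t <= 1 ->
    A (x + s *: (h *: u) + t *: (h *: v)).
  by move=> s t st t01; exact: Br (inB _ _ _ _ (lexx _) st t01).
have hyp2 : forall s t : R, 0 <= s <= 1 -> 0 <= t <= 1 ->
    A (x + s *: (h *: v) + t *: (h *: u)).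
  by move=> s t st t01; exact: Br (inB v u _ _ vu st t01).
have [s [t [s01 t01 e1]]] := key _ _ _ hyp1.
have [s' [t' [s01' t01' e1']]] := key _ _ _ hyp2.
have E : 'D_v ('D_u f) (x + s *: (h *: u) + t *: (h *: v)) =
         'D_u ('D_v f) (x + s' *: (h *: v) + t' *: (h *: u)).
  (* The second difference is symmetric in the two sides of the parallelogram, so both expressions
     equal it after multiplication by [h * h]. *)
  apply: (@mulfI _ (h * h)); first by rewrite mulf_neq0// gt_eqF.
  rewrite -e1 -e1' [x + h *: v + h *: u]addrAC; ring.
exact: ex_intro2 _ _ _ (inB v u _ _ vu s01' t01')
  (ex_intro2 _ _ _ (inB _ _ _ _ (lexx _) s01 t01) (esym E)).
Qed.

(** * Gronwall's lemma *)

Lemma is_derive_sumr (R : realType) (V W : normedModType R) (I : Type)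
  (r : seq I) (f : I -> V -> W) (df : I -> W) (x v : V) :
  (forall i, is_derive x v (f i) (df i)) ->
  is_derive x v (fun y => \sum_(i <- r) f i y) (\sum_(i <- r) df i).
Proof.
move=> fd; elim: r => [|i r IH].
  rewrite big_nil (_ : (fun _ => _) = cst 0); first exact: is_derive_cst.
  by apply/funext => y; rewrite big_nil.
rewrite big_cons (_ : (fun _ => _) = f i + (fun y => \sum_(i <- r) f i y)).
  exact: is_deriveD.
by apply/funext => y; rewrite big_cons.
Qed.

(** The sum of squares [u] is differentiable, unlike the sum of absolute values, and satisfies u' <=
    C u. Hence u(t) exp(- C t) does not increase; it starts at 0 and is nonnegative. *)
Lemma gronwall (R : realType) (I : finType) (F dF : I -> R -> R) (a b K : R) :
  0 <= K ->
  (forall i t, a < t < b -> is_derive t 1 (F i) (dF i t)) ->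
  (forall i, {within `[a, b], continuous (F i)}) ->
  (forall i, F i a = 0) ->
  (forall i t, a < t < b -> `|dF i t| <= K * \sum_j `|F j t|) ->
  forall i t, a <= t <= b -> F i t = 0.
Proof.
move=> K0 Fd Fc Fa dFK i0 t tab.
have /andP[at_ tb] := tab.
pose u t := \sum_i F i t ^+ 2.
(* u' is at most the sum over i and j of 2 K |F_i| |F_j| <= K (F_i^2 + F_j^2), and each square
   occurs 2 |I| times in this double sum. *)
pose C : R := K * #|I|%:R * 2.
pose w t := u t * expR (- C * t).
have ud s : a < s < b -> is_derive s 1 u (\sum_i 2 * F i s * dF i s).
  move=> sab; apply: is_derive_sumr => i.
  have di := Fd i s sab.
  rewrite (_ : (fun y => _) = F i * F i); last by apply/funext => y; rewrite expr2.
  apply: is_derive_eq; rewrite /GRing.scale/=; ring.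
have wd s : a < s < b ->
    is_derive s 1 w (((\sum_i 2 * F i s * dF i s) - C * u s) * expR (- C * s)).
  move=> /ud us.
  have es : is_derive s 1 (fun s => expR (- C * s)) (- C * expR (- C * s)).
    have := @is_derive1_comp R _ expR (fun s => - C * s) s (- C) (expR (- C * s)).
    by apply; apply: is_derive_eq; rewrite [X in X = _]mulr1.
  have -> : w = u * (fun s => expR (- C * s)) by [].
  apply: is_derive_eq; rewrite /GRing.scale/=; ring.
have wle : w t <= w a.
  have a_in : a \in `[a, b]%R by rewrite in_itv/= lexx/= (le_trans at_).
  have t_in : t \in `[a, b]%R by rewrite in_itv/= at_.
  apply: (@ler0_derive1_le_cc R w a b _ _ _ t a t_in a_in at_).
  - by move=> s; rewrite in_itv/= => /wd ws; exact: ex_derive.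
  - move=> s; rewrite in_itv/= => sab; rewrite derive1E; have [_ ->] := wd s sab.
    rewrite pmulr_lle0; last exact: expR_gt0.
    rewrite subr_le0 /C /u.
    apply: (@le_trans _ _ (\sum_i \sum_j K * (F i s ^+ 2 + F j s ^+ 2))).
      apply: ler_sum => i _; apply: (@le_trans _ _ (2 * `|F i s| * `|dF i s|)).
        by rewrite (le_trans (ler_norm _))// !normrM ger0_norm.
      apply: (@le_trans _ _ (2 * `|F i s| * (K * \sum_j `|F j s|))).
        by rewrite ler_wpM2l ?dFK// mulr_ge0.
      rewrite mulrCA -mulr_sumr ler_wpM2l// mulr_sumr; apply: ler_sum => j _.
      rewrite -(real_normK (num_real (F i s))) -(real_normK (num_real (F j s))).
      have := sqr_ge0 (`|F i s| - `|F j s|); rewrite sqrrB; lra.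
    rewrite (eq_bigr (fun i => K * #|I|%:R * F i s ^+ 2 + K * \sum_j F j s ^+ 2)); last first.
      move=> i _; rewrite -mulr_sumr big_split/= mulrDr sumr_const -mulr_natl; ring.
    rewrite big_split/= -mulr_sumr sumr_const -mulr_natl [in leRHS]mulr2n; lra.
  - move=> s; rewrite /w; apply: continuousM.
      rewrite /u; apply: (cvg_sumr (F := nbhs s)) => i; rewrite expr2.
      by apply: cvgM; exact: Fc.
    apply: continuous_subspaceT => r; apply: differentiable_continuous.
    apply/derivable1_diffP; apply: ex_derive.
have wa : w a = 0 by rewrite /w /u big1 ?mul0r// => i _; rewrite Fa expr0n.
move: wle; rewrite wa /w pmulr_lle0 ?expR_gt0// => u0.
have /eqP : u t = 0.
  by apply/eqP; rewrite eq_le u0 sumr_ge0// => i _; rewrite sqr_ge0.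
rewrite psumr_eq0 => [/allP/(_ i0)|i _]; last exact: sqr_ge0.
by rewrite mem_index_enum sqrf_eq0 => /(_ isT)/eqP.
Qed.

(** * Linear algebra *)

Lemma posdef_unitmx (R : realType) (m : nat) (G : 'M[R]_m) :
  (forall u, u != 0 -> 0 < bilin G u u) -> G \in unitmx.
Proof.
move=> Gpos; rewrite unitmxE unitfE; apply/negP => /det0P[u u0 uG].
by have := Gpos u u0; rewrite /bilin uG mul0mx mxE ltxx.
Qed.

(** The kernel leaves rank at most 1, so all 2 by 2 minors vanish. For a skew matrix the minor on
    rows and columns i, j is the square of the entry (i, j). *)
Lemma skew_rank1_eq0 (R : realType) (m : nat) (N : 'M[R]_m) (U : 'M[R]_(m.-1, m)) :
  (0 < m)%N -> N^T = - N -> row_free U -> U *m N = 0 -> N = 0.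
Proof.
move=> m0 skewN /eqP rU UN.
have rN : (\rank N <= 1)%N.
  by have := mulmx0_rank_max UN; rewrite rU -[X in (_ <= X)%N](prednK m0) -addn1 leq_add2l.
(* Read off from the factorisation [col_base N *m row_base N], whose inner dimension is 0 or 1. *)
have minor i j k l : N i j * N k l = N i l * N k j.
  rewrite -(mulmx_base N) !mxE.
  case: (\rank N) rN (col_base N) (row_base N) => [|[|//]] _ A B.
    by rewrite !big_ord0 !mul0r.
  by rewrite !big_ord_recl !big_ord0 !addr0; ring.
have Nskew i j : N j i = - N i j by have /matrixP/(_ i j) := skewN; rewrite !mxE.
have Nii i : N i i = 0 by have := Nskew i i; lra.
apply/matrixP => i j; rewrite mxE; apply/eqP; rewrite -sqrf_eq0 expr2.
by have := minor i j j i; rewrite !Nii mul0r [N j i]Nskew mulrN => /eqP; rewrite oppr_eq0.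
Qed.

Lemma norm_mulmx (R : realType) (m n : nat) (w : 'rV[R]_m) (P : 'M[R]_(m, n)) :
  `|w *m P| <= m%:R * (`|w| * `|P|).
Proof.
apply: norm_le_coord => [|i j]; first by rewrite !mulr_ge0.
rewrite mxE (le_trans (ler_norm_sum _ _ _))//.
rewrite (_ : m%:R * _ = \sum_(k < m) `|w| * `|P|); last first.
  by rewrite sumr_const card_ord mulr_natl.
by apply: ler_sum => k _; rewrite normrM ler_pM// coord_le_norm.
Qed.

(** With N the inverse of G(x), w = w G(y) N + w (G(x) - G(y)) N, and near [x] the last term is at
    most |w| / 2, so it is absorbed on the left. This solves for second derivatives in the estimates
    with a constant that is uniform near [x]. *)
Lemma near_mulmx_lower_bound (R : realType) (V : normedModType R) (m : nat)
  (G : V -> 'M[R]_m) (x : V) : {for x, continuous G} -> G x \in unitmx ->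
  exists2 K, 0 <= K & \forall y \near x, forall w : 'rV[R]_m, `|w| <= K * `|w *m G y|.
Proof.
move=> cG Gu; pose N := invmx (G x).
(* Chosen so that d m^2 |N| <= 1/2: each of two products by a matrix costs a factor [m] in the
   maximum norm. The [+ 1] keeps the denominator positive. *)
pose d := (2 * (m%:R * m%:R * `|N|) + 1)^-1.
have mN : 0 <= m%:R * m%:R * `|N| by rewrite !mulr_ge0.
have d0 : 0 < d by rewrite invr_gt0 ltr_wpDl// mulr_ge0.
have dmN : d * (m%:R * m%:R * `|N|) <= 2^-1.
  rewrite mulrC ler_pdivrMr ?ltr_wpDl// ?mulr_ge0//.
  by move: (m%:R * _ * _) => z; lra.
exists (2 * (m%:R * `|N|)); first by rewrite !mulr_ge0.
have /cvgrPdist_le/(_ _ d0) := cG; apply: filterS => y Gy w.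
have Ew : w = w *m G y *m N + w *m (G x - G y) *m N.
  by rewrite -mulmxDl -mulmxDr addrC subrK -mulmxA mulmxV// mulmx1.
have b1 : `|w *m G y *m N| <= m%:R * (`|w *m G y| * `|N|) by exact: norm_mulmx.
have b2 : `|w *m (G x - G y) *m N| <= `|w| / 2.
  rewrite (le_trans (norm_mulmx _ _))//.
  apply: (@le_trans _ _ (m%:R * ((m%:R * (`|w| * d)) * `|N|))).
    rewrite ler_wpM2l// ler_wpM2r// (le_trans (norm_mulmx _ _))//.
    by rewrite ler_wpM2l// ler_wpM2l.
  rewrite (_ : _ * _ = `|w| * (d * (m%:R * m%:R * `|N|))); last by ring.
  exact: ler_wpM2l.
have : `|w| <= m%:R * (`|w *m G y| * `|N|) + `|w| / 2.
  by rewrite {1}Ew (le_trans (ler_normD _ _))// lerD.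
by move=> *; lra.
Qed.

(** * Killing fields in a coordinate domain *)

Lemma near_family_bounded (R : realType) (V : normedModType R) (I : finType)
  (f : I -> V -> R) (x : V) : (forall i, {for x, continuous (f i)}) ->
  exists2 B, 0 <= B & \forall y \near x, forall i, `|f i y| <= B.
Proof.
move=> cf; exists (\sum_i `|f i x| + 1); first by rewrite addr_ge0// sumr_ge0.
apply: filter_forall => i.
have /cvgrPdist_le/(_ _ ltr01) := cf i; apply: filterS => y fxy.
have -> : f i y = f i x - (f i x - f i y) by ring.
rewrite (le_trans (ler_normB _ _))// lerD// (bigD1 i)//= lerDl.
by rewrite sumr_ge0.
Qed.

Lemma norm_sum_le (R : realType) (n : nat) (f : 'I_n -> R) (c : R) :
  (forall i, `|f i| <= c) -> `|\sum_i f i| <= n%:R * c.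
Proof.
move=> fc; rewrite (le_trans (ler_norm_sum _ _ _))//.
rewrite (_ : n%:R * c = \sum_(i < n) c); first by apply: ler_sum.
by rewrite sumr_const card_ord mulr_natl.
Qed.

Lemma is_derive_segment (R : realType) (m : nat) (A : set 'rV[R]_m)
  (f : 'rV[R]_m -> R) (x v : 'rV[R]_m) (t : R) : open A -> Ck 1 A f ->
  A (x + t *: v) ->
  is_derive t 1 (fun s => f (x + s *: v)) (\sum_i v 0 i * 'D_('e_i) f (x + t *: v)).
Proof.
move=> oA Cf Ax; rewrite -(derive_sum_coord _ oA Cf Ax).
exact: is_derive_line (Ck_derivable Cf Ax).
Qed.

Lemma is_derive_sum3M (R : realType) (V : normedModType R)
  (a a' b b' c c' : V -> R) (da da' db db' dc dc' : R) (x v : V) :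
  is_derive x v a da -> is_derive x v a' da' ->
  is_derive x v b db -> is_derive x v b' db' ->
  is_derive x v c dc -> is_derive x v c' dc' ->
  is_derive x v (fun y => a y * a' y + b y * b' y + c y * c' y)
    (da * a' x + a x * da' + (db * b' x + b x * db') + (dc * c' x + c x * dc')).
Proof.
move=> ha ha' hb hb' hc hc'.
have H := is_deriveD (is_deriveD (is_deriveM ha ha') (is_deriveM hb hb')) (is_deriveM hc hc').
by refine (@is_derive_eq _ _ _ _ _ _ _ _ H _); rewrite /GRing.scale/=; ring.
Qed.

Lemma is_deriveM3 (R : realType) (V : normedModType R) (a b c : V -> R)
  (da db dc : R) (x v : V) :
  is_derive x v a da -> is_derive x v b db -> is_derive x v c dc ->
  is_derive x v (fun y => a y * (b y * c y))
    (da * (b x * c x) + a x * (db * c x + b x * dc)).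
Proof.
move=> ha hb hc; have H := is_deriveM ha (is_deriveM hb hc).
refine (@is_derive_eq _ _ _ _ _ _ _ _ H _).
by rewrite /GRing.scale/= -[(b * c) x]/(b x * c x); ring.
Qed.

(** [E h i j] is the Killing equation (i, j) differentiated in direction h. The combination (i, j,
    k) + (j, i, k) - (k, i, j), the one that builds Christoffel symbols from the metric, isolates
    the second derivatives of X. The result is the invariance of the Levi-Civita connection under X,
    with a lowered index and doubled. *)
Lemma killing_second_order_algebra (R : comPzRingType) (m : nat) (X : 'I_m -> R)
  (dX g : 'I_m -> 'I_m -> R) (ddX dg : 'I_m -> 'I_m -> 'I_m -> R)
  (ddg : 'I_m -> 'I_m -> 'I_m -> 'I_m -> R) :
  (forall i j, g i j = g j i) ->
  (forall i j l, ddX i j l = ddX j i l) ->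
  (forall h k i j, ddg h k i j = ddg k h i j) ->
  (forall h i j, \sum_l
     (dX h l * dg l i j + X l * ddg h l i j + (dg h l j * dX i l + g l j * ddX h i l)
      + (dg h i l * dX j l + g i l * ddX h j l)) = 0) ->
  forall i j k, \sum_l
    (X l * (ddg l i j k + ddg l j i k - ddg l k i j)
     + dX i l * (dg l j k + dg j l k - dg k l j)
     + dX j l * (dg i l k + dg l i k - dg k i l)
     + dX k l * (dg i j l + dg j i l - dg l i j) + 2 * (ddX i j l * g l k)) = 0.
Proof.
move=> gC ddXC ddgC E i j k.
rewrite -[RHS](subr0 0) -[X in _ = X - _]addr0 -[X in _ = X + _ - _](E i j k).
rewrite -[X in _ = _ + X - _](E j i k) -[X in _ = _ - X](E k i j).
rewrite -big_split -sumrB /=.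
apply: eq_bigr => l _.
rewrite [ddg i l j k]ddgC [ddg j l i k]ddgC [ddg k l i j]ddgC.
rewrite [ddX j i l]ddXC [ddX k i l]ddXC [ddX k j l]ddXC [g j l]gC; ring.
Qed.

(** All values are taken at the point t x of a ray; [p] and [w] are the first and second
    t-derivatives of X(t x), and [v] is x L. Contracting the second-order Killing equation with x^i
    x^j and subtracting the radial identity differentiated along [v] leaves the Jacobi equation,
    linear and homogeneous in X - t v and p - v. *)
Lemma jacobi_algebra (R : comPzRingType) (m : nat) (t : R) (X x v p w : 'I_m -> R)
  (dX g : 'I_m -> 'I_m -> R) (ddX C : 'I_m -> 'I_m -> 'I_m -> R)
  (dC : 'I_m -> 'I_m -> 'I_m -> 'I_m -> R) (k : 'I_m) :
  (forall l, p l = \sum_i x i * dX i l) ->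
  (forall l, w l = \sum_i x i * \sum_j x j * ddX j i l) ->
  (forall i j, \sum_l (X l * dC l i j k + dX i l * C l j k + dX j l * C i l k
                       + dX k l * C i j l + 2 * (ddX i j l * g l k)) = 0) ->
  (forall l, \sum_i \sum_j C i j l * (x i * x j) = 0) ->
  \sum_i \sum_j ((t * \sum_l v l * dC l i j k) * (x i * x j)
                 + C i j k * (v i * x j + x i * v j)) = 0 ->
  2 * \sum_l w l * g l k
  + \sum_i \sum_j ((\sum_l (X l - t * v l) * dC l i j k) * (x i * x j)
      + C i j k * ((p i - v i) * x j + x i * (p j - v j))) = 0.
Proof.
move=> pE wE H1 H2 H3.
pose T1 := \sum_i \sum_j (\sum_l X l * dC l i j k) * (x i * x j).
pose T2 := \sum_i \sum_j C i j k * (p i * x j).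
pose T3 := \sum_i \sum_j C i j k * (x i * p j).
have T2E : \sum_i \sum_j (\sum_l dX i l * C l j k) * (x i * x j) = T2.
  rewrite exchange_big/= /T2 [RHS]exchange_big/=; apply: eq_bigr => j _.
  rewrite (eq_bigr (fun i => \sum_l dX i l * C l j k * (x i * x j))); last first.
    by move=> i _; rewrite mulr_suml.
  rewrite exchange_big/=; apply: eq_bigr => l _.
  by rewrite pE mulr_suml mulr_sumr; apply: eq_bigr => i _; ring.
have T3E : \sum_i \sum_j (\sum_l dX j l * C i l k) * (x i * x j) = T3.
  apply: eq_bigr => i _.
  rewrite (eq_bigr (fun j => \sum_l dX j l * C i l k * (x i * x j))); last first.
    by move=> j _; rewrite mulr_suml.
  rewrite exchange_big/=; apply: eq_bigr => l _.
  by rewrite pE !mulr_sumr; apply: eq_bigr => j _; ring.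
(* The free index [k] sits on the derivative of X here, so the contraction with x^i x^j is a
   combination of radial identities. *)
have T4E : \sum_i \sum_j (\sum_l dX k l * C i j l) * (x i * x j) = 0.
  rewrite (eq_bigr (fun i => \sum_l \sum_j dX k l * (C i j l * (x i * x j)))); last first.
    move=> i _; rewrite exchange_big/=; apply: eq_bigr => j _.
    by rewrite mulr_suml; apply: eq_bigr => l _; ring.
  rewrite exchange_big/= big1// => l _.
  transitivity (dX k l * \sum_i \sum_j C i j l * (x i * x j)); last by rewrite H2 mulr0.
  by rewrite mulr_sumr; apply: eq_bigr => i _; rewrite mulr_sumr.
have T5E : \sum_i \sum_j (\sum_l 2 * (ddX i j l * g l k)) * (x i * x j) =
    2 * \sum_l w l * g l k.
  rewrite exchange_big/= mulr_sumr.
  rewrite (eq_bigr (fun j => \sum_l \sum_i 2 * (ddX i j l * g l k) * (x i * x j))); last first.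
    move=> j _; rewrite exchange_big/=; apply: eq_bigr => i _.
    by rewrite mulr_suml.
  rewrite exchange_big/=; apply: eq_bigr => l _.
  rewrite wE mulr_suml mulr_sumr; apply: eq_bigr => i _.
  by rewrite mulr_sumr mulr_suml mulr_sumr; apply: eq_bigr => j _; ring.
have S : T1 + T2 + T3 + 2 * (\sum_l w l * g l k) = 0.
  rewrite -[T1 + T2 + T3]addr0 -[X in T1 + T2 + T3 + X]T4E -T2E -T3E -T5E.
  rewrite /T1 -!big_split/= big1// => i _.
  rewrite -!big_split/= big1// => j _; rewrite -!mulrDl -!big_split/=.
  by rewrite H1 mul0r.
rewrite (_ : \sum_i \sum_j _ = T1 + T2 + T3 - 0); last first.
  rewrite -[X in _ = _ - X]H3 /T1 /T2 /T3 -!big_split/= -sumrB; apply: eq_bigr => i _.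
  rewrite -!big_split/= -sumrB; apply: eq_bigr => j _.
  rewrite (eq_bigr (fun l => X l * dC l i j k - t * (v l * dC l i j k))); last first.
    by move=> l _; ring.
  by rewrite sumrB -mulr_sumr; ring.
by rewrite subr0 addrC S.
Qed.

(** Twice the Christoffel symbols of the first kind. *)
Definition christoffel_lower (R : realType) (m : nat)
    (G : 'rV[R]_m -> 'M[R]_m) (i j k : 'I_m) (y : 'rV[R]_m) : R :=
  'D_('e_i) (fun z => G z j k) y + 'D_('e_j) (fun z => G z i k) y
  - 'D_('e_k) (fun z => G z i j) y.

Section KillingChart.
Context {R : realType} {m : nat}.
Variables (U : set 'rV[R]_m) (G : 'rV[R]_m -> 'M[R]_m)
  (xi : 'rV[R]_m -> 'rV[R]_m).
Hypotheses (oU : open U) (sG : smooth U G) (sxi : smooth U xi).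
Hypothesis Gsym : forall x, U x -> (G x)^T = G x.
Hypothesis Gpos : forall x, U x -> forall u, u != 0 -> 0 < bilin (G x) u u.
Hypothesis killing_xi : forall x, U x -> forall i j,
  \sum_k (xi x 0 k * 'D_('e_k) (fun y => G y i j) x
          + G x k j * 'D_('e_i) (fun y => xi y 0 k) x
          + G x i k * 'D_('e_j) (fun y => xi y 0 k) x) = 0.

Let g i j y := G y i j.
Let X l y := xi y 0 l.
Let dg h i j := 'D_('e_h) (g i j).
Let dX i l := 'D_('e_i) (X l).
Let ddX i j l := 'D_('e_i) (dX j l).
Let C := christoffel_lower G.

Let Ckg k i j : Ck k U (g i j).
Proof. exact: (Ck_mxP k G oU).1 (sG k) i j. Qed.

Let CkX k l : Ck k U (X l).
Proof. exact: (Ck_mxP k xi oU).1 (sxi k) 0 l. Qed.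

Let Ckdg k h i j : Ck k U (dg h i j).
Proof. exact: Ck_derive. Qed.

Let CkdX k i l : Ck k U (dX i l).
Proof. exact: Ck_derive. Qed.

Let CE i j k : C i j k = dg i j k + dg j i k - dg k i j.
Proof. by []. Qed.

Let CkN k f : Ck k U f -> Ck k U (- f : 'rV[R]_m -> R).
Proof.
move=> Cf; have : Ck k U (cst (-1 : R) \* f) by apply: CkM => //; exact: Ck_cst.
by apply: Ck_eq => // x _ /=; rewrite mulN1r.
Qed.

Let CkC k i j h : Ck k U (C i j h).
Proof. by rewrite CE; apply: CkD => //; [exact: CkD|exact: CkN]. Qed.

Let dCE x l i j k : U x ->
  'D_('e_l) (C i j k) x = 'D_('e_l) (dg i j k) x + 'D_('e_l) (dg j i k) x
                          - 'D_('e_l) (dg k i j) x.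
Proof.
move=> Ux; have d a b c : derivable (dg a b c) x 'e_l by exact: Ck_derivable (Ckdg _ _ _ _) Ux.
by rewrite CE deriveB ?deriveD//; exact: derivableD.
Qed.

Let killing_derive x h i j : U x ->
  \sum_l
    (dX h l x * dg l i j x + X l x * 'D_('e_h) (dg l i j) x +
     (dg h l j x * dX i l x + g l j x * ddX h i l x) +
     (dg h i l x * dX j l x + g i l x * ddX h j l x)) = 0.
Proof.
move=> Ux.
pose S y := \sum_l (X l y * dg l i j y + g l j y * dX i l y + g i l y * dX j l y).
have : 'D_('e_h) S x = 0.
  rewrite -(derive_cst (0 : R) x 'e_h); apply: near_eq_derive.
  near=> y; apply: killing_xi; near: y; exact: open_nbhs_nbhs.
have dS : is_derive x 'e_h S (\sum_l
  ((dX h l x * dg l i j x + X l x * 'D_('e_h) (dg l i j) x) +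
   (dg h l j x * dX i l x + g l j x * ddX h i l x) +
   (dg h i l x * dX j l x + g i l x * ddX h j l x))).
  apply: is_derive_sumr => l.
  apply: is_derive_sum3M; apply: derivableP.
  - exact: Ck_derivable (CkX 1 l) Ux.
  - exact: Ck_derivable (Ckdg 1 l i j) Ux.
  - exact: Ck_derivable (Ckg 1 l j) Ux.
  - exact: Ck_derivable (CkdX 1 i l) Ux.
  - exact: Ck_derivable (Ckg 1 i l) Ux.
  - exact: Ck_derivable (CkdX 1 j l) Ux.
by case: dS => _ ->.
Unshelve. all: by end_near. Qed.

Let ddX_sym x i j l : U x -> ddX i j l x = ddX j i l x.
Proof. by move=> Ux; apply: (derive_symmetric _ _ oU (CkX 2 l) Ux). Qed.

Let killing_second_order x i j k : U x ->
  \sum_l (X l x * 'D_('e_l) (C i j k) x + dX i l x * C l j k x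
          + dX j l x * C i l k x + dX k l x * C i j l x
          + 2 * (ddX i j l x * G x l k)) = 0.
Proof.
move=> Ux.
have gC a b : g a b x = g b a x by rewrite /g -{1}(Gsym Ux) mxE.
have dgC a b c d : 'D_('e_a) (dg b c d) x = 'D_('e_b) (dg a c d) x.
  exact: (derive_symmetric _ _ oU (Ckg 2 c d) Ux).
rewrite -[RHS](@killing_second_order_algebra R m (X^~ x) (fun i l => dX i l x)
  (fun i j => g i j x) (fun i j l => ddX i j l x) (fun h i j => dg h i j x)
  (fun h k i j => 'D_('e_h) (dg k i j) x) gC (fun i j l => ddX_sym i j l Ux) dgC
  (fun h i j => killing_derive h i j Ux) i j k).
by apply: eq_bigr => l _; rewrite dCE.
Qed.

(** Uniform constants for the Gronwall estimates on segments issuing from [q]: [K] undoes the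
    multiplication by the metric, [B] bounds the coefficients. *)
Let near_coefficients q : U q -> exists K B : R, [/\ 0 <= K, 0 <= B &
  \forall y \near q, [/\ U y, forall w : 'rV[R]_m, `|w| <= K * `|w *m G y|,
    forall i j k, `|C i j k y| <= B &
    forall l i j k, `|'D_('e_l) (C i j k) y| <= B]].
Proof.
move=> Uq.
have [K K0 nK] := near_mulmx_lower_bound (Ck_continuous (sG 0) Uq)
  (posdef_unitmx (Gpos Uq)).
have [|B1 B10 nB1] := @near_family_bounded R _ ('I_m * 'I_m * 'I_m)%type
    (fun p => C p.1.1 p.1.2 p.2) q.
  by move=> p; exact: Ck_continuous (CkC 0 _ _ _) Uq.
have [|B2 B20 nB2] := @near_family_bounded R _ ('I_m * ('I_m * 'I_m * 'I_m))%type
    (fun p => 'D_('e_(p.1)) (C p.2.1.1 p.2.1.2 p.2.2)) q.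
  by move=> p; exact: Ck_continuous (Ck_derive _ (CkC 1 _ _ _)) Uq.
exists K, (B1 + B2); split => //; first exact: addr_ge0.
have nU : nbhs q U by exact: open_nbhs_nbhs.
have : \forall y \near q, (U y /\ (forall w : 'rV[R]_m, `|w| <= K * `|w *m G y|)) /\
    ((forall p : 'I_m * 'I_m * 'I_m, `|C p.1.1 p.1.2 p.2 y| <= B1) /\
     (forall p : 'I_m * ('I_m * 'I_m * 'I_m),
        `|'D_('e_(p.1)) (C p.2.1.1 p.2.1.2 p.2.2) y| <= B2)).
  by apply: filterI; apply: filterI.
apply: filterS => y [[Uy Ky] [B1y B2y]]; split => //.
  by move=> i j k; rewrite (le_trans (B1y (i, j, k)))// lerDl.
by move=> l i j k; rewrite (le_trans (B2y (l, (i, j, k))))// lerDr.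
Qed.

Let in_ball q (v : 'rV[R]_m) (r t : R) : `|v| < r -> 0 <= t <= 1 ->
  ball q r (q + t *: v).
Proof.
move=> vr /andP[t0 t1]; rewrite -ball_normE/= opprD addrA subrr add0r normrN.
by rewrite normrZ ger0_norm// (le_lt_trans _ vr)// ler_piMl.
Qed.

(* The second derivatives of xi are linear functions of its 1-jet. *)
Lemma killing_near0 q : U q -> xi q = 0 ->
  (forall i l, 'D_('e_i) (fun y => xi y 0 l) q = 0) -> \forall y \near q, xi y = 0.
Proof.
move=> Uq xiq dxiq.
have [K [B [K0 B0 /nbhs_ballP[r /= r0 Br]]]] := near_coefficients Uq.
apply/nbhs_ballP; exists r => // z zr.
pose v := z - q.
have vr : `|v| < r by move: zr; rewrite -ball_normE/= distrC.
(* The sum type merges values and first derivatives into one family, the 1-jet of [xi] along the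
   segment from [q] to [z]. *)
pose F (s : 'I_m + 'I_m * 'I_m) (t : R) :=
  match s with inl l => X l (q + t *: v) | inr p => dX p.1 p.2 (q + t *: v) end.
pose dF (s : 'I_m + 'I_m * 'I_m) (t : R) :=
  match s with
  | inl l => \sum_i v 0 i * dX i l (q + t *: v)
  | inr p => \sum_i v 0 i * ddX i p.1 p.2 (q + t *: v)
  end.
pose S t := \sum_s `|F s t|.
have S0 t : 0 <= S t by exact: sumr_ge0.
have leS s t : `|F s t| <= S t by rewrite /S (bigD1 s)//= lerDl sumr_ge0.
have leSX l t : `|X l (q + t *: v)| <= S t by exact: (leS (inl l)).
have leSdX i l t : `|dX i l (q + t *: v)| <= S t by exact: (leS (inr (i, l))).
have BU (t : R) : 0 <= t <= 1 -> U (q + t *: v) by move=> /(in_ball q vr)/Br[].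
have Fd s (t : R) : 0 <= t <= 1 -> is_derive t 1 (F s) (dF s t).
  move=> /BU Ut; case: s => [l|[i l]].
    exact: is_derive_segment oU (CkX 1 l) Ut.
  exact: is_derive_segment oU (CkdX 1 i l) Ut.
(* The second-order equation has four terms per summation index besides the second derivatives, each
   at most [B * S t]. *)
have ddXle i j l (t : R) : 0 <= t <= 1 ->
    `|ddX i j l (q + t *: v)| <= K * (m%:R * (4 * (B * S t))).
  move=> t01; have [Ut Kt Ct dCt] := Br _ (in_ball q vr t01).
  pose w : 'rV[R]_m := \row_l ddX i j l (q + t *: v).
  have -> : ddX i j l (q + t *: v) = w 0 l by rewrite mxE.
  rewrite (le_trans (coord_le_norm _ _ _))// (le_trans (Kt w))// ler_wpM2l//.
  apply: norm_le_coord => [|a k]; first by rewrite !mulr_ge0.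
  have := killing_second_order i j k Ut; rewrite big_split/= -mulr_sumr.
  rewrite mxE ord1.
  set s1 := \sum_l (_ + _); set s2 := \sum_(l < m) _ => E.
  have s1b : `|s1| <= m%:R * (4 * (B * S t)).
    apply: norm_sum_le => b.
    have bb (x y : R) : `|x| <= S t -> `|y| <= B -> `|x * y| <= B * S t.
      by move=> xS yB; rewrite normrM mulrC ler_pM.
    rewrite (_ : 4 * _ = B * S t + B * S t + B * S t + B * S t); last by ring.
    do 3 (apply: (le_trans (ler_normD _ _)); apply: lerD; last by apply: bb).
    by apply: bb.
  have -> : \sum_(j0 < m) w 0 j0 * G (q + t *: v) j0 k = s2.
    by apply: eq_bigr => b _; rewrite mxE.
  have s1E : s1 = - 2 * s2 by lra.
  move: s1b; rewrite s1E normrM normrN (ger0_norm (ler0n _ 2)).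
  by have := normr_ge0 s2; lra.
have Fl s (t : R) : 0 <= t <= 1 ->
    `|dF s t| <= m%:R * (`|v| * (1 + K * (m%:R * (4 * B)))) * S t.
  move=> t01; rewrite -mulrA; case: s => [l|[j l]]; apply: norm_sum_le => i.
    rewrite normrM -mulrA ler_pM// ?coord_le_norm// (le_trans (leSdX i l t))//.
    by rewrite ler_peMl// lerDl !mulr_ge0.
  rewrite normrM -mulrA ler_pM// ?coord_le_norm// (le_trans (ddXle i j l t t01))//.
  have -> : K * (m%:R * (4 * (B * S t))) = K * (m%:R * (4 * B)) * S t by ring.
  by rewrite [leRHS]mulrDl mul1r lerDr.
have F1 s : F s 1 = 0.
  apply: (@gronwall R _ F dF 0 1 (m%:R * (`|v| * (1 + K * (m%:R * (4 * B))))));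
    last by rewrite lexx ler01.
  - by rewrite !mulr_ge0// addr_ge0// !mulr_ge0.
  - by move=> i t /andP[t0 t1]; apply: Fd; rewrite !ltW.
  - move=> i; apply: derivable_within_continuous => t; rewrite in_itv/= => t01.
    by have := Fd i t t01 => d; exact: ex_derive.
  - by case=> [l|p]; rewrite /F scale0r addr0 ?/X ?xiq ?mxE//; exact: dxiq.
  - by move=> i t /andP[t0 t1]; apply: Fl; rewrite !ltW.
apply/rowP => l; rewrite mxE.
by have := F1 (inl l); rewrite /F scale1r addrC subrK.
Qed.

(* Along a segment t |-> t x, both xi and the linear field defined by its
   differential at 0 solve the Jacobi equation, with the same initial values. *)
Lemma killing_linear_near0 : U 0 -> xi 0 = 0 ->
  (\forall y \near (0 : 'rV[R]_m), forall k,
     \sum_i \sum_j christoffel_lower G i j k y * (y 0 i * y 0 j) = 0) ->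
  \forall y \near (0 : 'rV[R]_m),
     xi y = y *m \matrix_(i, l) 'D_('e_i) (fun z => xi z 0 l) 0.
Proof.
move=> U0 xi0 nC.
have [K [B [K0 B0 nK]]] := near_coefficients U0.
move: nC nK => /nbhs_ballP[r1 /= r10 Br1] /nbhs_ballP[r2 /= r20 Br2].
have {}Br1 y : ball 0 r1 y ->
    forall k, \sum_i \sum_j C i j k y * (y 0 i * y 0 j) = 0 by exact: Br1.
(* The bound 1 makes the coordinates of [x] at most 1, so they disappear from the constants
   below. *)
pose r := Num.min r1 (Num.min r2 1).
have r0 : 0 < r by rewrite !lt_min r10 r20 ltr01.
have [rr1 rr2 rr3] : [/\ r <= r1, r <= r2 & r <= 1] by rewrite /r !ge_min !lexx !orbT.
apply/nbhs_ballP; exists r => // x.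
rewrite -ball_normE/= sub0r normrN => xr.
have x1 i : `|x 0 i| <= 1.
  by rewrite (le_trans (coord_le_norm _ _ _))// ltW// (lt_le_trans xr).
pose L : 'M[R]_m := \matrix_(i, l) dX i l 0.
pose v := x *m L.
pose p (t : R) l := \sum_i x 0 i * dX i l (0 + t *: x).
(* The difference between X(t x) and the linear field t x L, together with its velocity: both vanish
   at [t = 0]. *)
pose F (s : 'I_m + 'I_m) (t : R) :=
  match s with inl l => X l (0 + t *: x) - t * v 0 l | inr l => p t l - v 0 l end.
pose dF (s : 'I_m + 'I_m) (t : R) :=
  match s with
  | inl l => p t l - v 0 l
  | inr l => \sum_i x 0 i * \sum_j x 0 j * ddX j i l (0 + t *: x)
  end.
pose S t := \sum_s `|F s t|.
have S0 t : 0 <= S t by exact: sumr_ge0.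
have leS s t : `|F s t| <= S t by rewrite /S (bigD1 s)//= lerDl sumr_ge0.
have BU (t : R) : 0 <= t <= 1 -> U (0 + t *: x) by move=> /(in_ball 0 xr)/(le_ball rr2)/Br2[].
have Fd s (t : R) : 0 <= t <= 1 -> is_derive t 1 (F s) (dF s t).
  move=> /BU Ut; case: s => l.
    have d1 := is_derive_segment oU (CkX 1 l) Ut.
    have d2 : is_derive t 1 (fun s : R => s * v 0 l) (v 0 l).
      by apply: is_derive_eq; rewrite scaler0 add0r [LHS]mulr1.
    exact: (is_deriveB d1 d2).
  have d1 : is_derive t 1 (fun s => p s l)
      (\sum_i x 0 i * \sum_j x 0 j * ddX j i l (0 + t *: x)).
    apply: is_derive_sumr => i.
    exact: (is_deriveZ _ (is_derive_segment oU (CkdX 1 i l) Ut)).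
  have := is_deriveB d1 (is_derive_cst (v 0 l) t 1); rewrite subr0; exact.
(* At the point t x the radial identity carries a factor [t ^+ 2], cancelled here for [t > 0];
   [gronwall] asks for its estimate on the open interval only. *)
have H2 (t : R) : 0 < t <= 1 -> forall k,
    \sum_i \sum_j C i j k (0 + t *: x) * (x 0 i * x 0 j) = 0.
  move=> /andP[t0 t1] k; have t01 : 0 <= t <= 1 by rewrite ltW.
  have := Br1 _ (le_ball rr1 (in_ball 0 xr t01)) k.
  rewrite (_ : \sum_i \sum_j _ = t ^+ 2 *
     \sum_i \sum_j C i j k (0 + t *: x) * (x 0 i * x 0 j)).
    by move/eqP; rewrite mulf_eq0 sqrf_eq0 (gt_eqF t0)/= => /eqP.
  rewrite mulr_sumr; apply: eq_bigr => i _; rewrite mulr_sumr; apply: eq_bigr => j _.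
  by rewrite add0r !mxE; ring.
(* The radial identity holds on a whole neighbourhood of t x, so it may be differentiated in the
   direction [v], transverse to the ray; one factor [t] is then cancelled. *)
have H3 (t : R) : 0 < t <= 1 -> forall k,
    \sum_i \sum_j ((t * \sum_l v 0 l * 'D_('e_l) (C i j k) (0 + t *: x)) * (x 0 i * x 0 j)
      + C i j k (0 + t *: x) * (v 0 i * x 0 j + x 0 i * v 0 j)) = 0.
  move=> /andP[t0 t1] k; have t01 : 0 <= t <= 1 by rewrite ltW.
  set y := 0 + t *: x.
  have Uy : U y by exact: BU.
  have yE i : y 0 i = t * x 0 i by rewrite /y add0r mxE.
  pose phi (z : 'rV[R]_m) := \sum_i \sum_j C i j k z * (z 0 i * z 0 j).
  have phi0 : 'D_v phi y = 0.
    rewrite -(derive_cst (0 : R) y v); apply: near_eq_derive.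
    near=> z; apply: Br1; near: z.
    apply: open_nbhs_nbhs; split; first exact: ball_open.
    exact: le_ball rr1 _ (in_ball 0 xr t01).
  have co i : is_derive y v (fun z : 'rV[R]_m => z 0 i) (v 0 i).
    have := @derive_coord R _ 1 m id y v 0 i (@derivable_id R _ y v).
    by rewrite derive_id.
  have dphi : is_derive y v phi (\sum_i \sum_j
      ((\sum_l v 0 l * 'D_('e_l) (C i j k) y) * (y 0 i * y 0 j)
       + C i j k y * (v 0 i * y 0 j + y 0 i * v 0 j))).
    apply: is_derive_sumr => i; apply: is_derive_sumr => j.
    apply: is_deriveM3 => //; rewrite -(derive_sum_coord v oU (CkC 1 i j k) Uy).
    by apply: derivableP; exact: Ck_derivable (CkC 1 i j k) Uy.
  apply: (mulfI (lt0r_neq0 t0)); rewrite mulr0 -[RHS]phi0.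
  case: dphi => _ ->; rewrite mulr_sumr; apply: eq_bigr => i _.
  by rewrite mulr_sumr; apply: eq_bigr => j _; rewrite !yE; ring.
(* [m * m] counts the pairs (i, j); for each pair, the derivative of the Christoffel symbol
   contributes [m] terms and the symbol itself 2. *)
have Fl s (t : R) : 0 < t < 1 ->
    `|dF s t| <= (1 + K * (m%:R * (m%:R * ((m%:R + 2) * B)))) * S t.
  move=> /andP[t0 t1]; have t01 : 0 <= t <= 1 by rewrite !ltW.
  have t01' : 0 < t <= 1 by rewrite t0 ltW.
  rewrite mulrDl mul1r; case: s => l.
    by rewrite (le_trans (leS (inr l) t))// lerDl !mulr_ge0// addr_ge0.
  have [Ut Kt Ct dCt] := Br2 _ (le_ball rr2 (in_ball 0 xr t01)).
  pose w : 'rV[R]_m := \row_l dF (inr l) t.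
  have -> : dF (inr l) t = w 0 l by rewrite mxE.
  rewrite (le_trans (coord_le_norm _ _ _))// (le_trans (Kt w))//.
  apply: (@le_trans _ _ (K * (m%:R * (m%:R * ((m%:R + 2) * B))) * S t)); last by rewrite lerDr.
  rewrite -mulrA ler_wpM2l//.
  apply: norm_le_coord => [|a k]; first by rewrite !mulr_ge0// addr_ge0.
  have := @jacobi_algebra R m t (fun l => X l (0 + t *: x)) (x 0) (v 0) (p t)
    (fun l => dF (inr l) t) (fun i l => dX i l (0 + t *: x)) (fun l k => G (0 + t *: x) l k)
    (fun i j l => ddX i j l (0 + t *: x)) (fun i j k => C i j k (0 + t *: x))
    (fun l i j k => 'D_('e_l) (C i j k) (0 + t *: x)) k (fun=> erefl) (fun=> erefl)
    (fun i j => killing_second_order i j k Ut) (H2 t t01') (H3 t t01' k).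
  rewrite mxE ord1 (_ : \sum_(j < m) w 0 j * G (0 + t *: x) j k =
    \sum_(j < m) dF (inr j) t * G (0 + t *: x) j k); last first.
    by apply: eq_bigr => b _; rewrite mxE.
  set s2 := \sum_(j < m) dF (inr j) t * _; set s1 := \sum_i \sum_j _ => E.
  have s1b : `|s1| <= m%:R * (m%:R * ((m%:R + 2) * B)) * S t.
    rewrite -!mulrA; apply: norm_sum_le => i; apply: norm_sum_le => j.
    rewrite (_ : (m%:R + 2) * (B * S t) =
      m%:R * (B * S t) * (1 * 1) + B * (S t * 1 + 1 * S t)); last by ring.
    rewrite (le_trans (ler_normD _ _))// lerD//.
      rewrite normrM ler_pM//; last by rewrite normrM ler_pM.
      by apply: norm_sum_le => b; rewrite normrM mulrC ler_pM//; exact: (leS (inl b)).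
    rewrite normrM ler_pM// (le_trans (ler_normD _ _))// !normrM lerD// ler_pM//.
      exact: (leS (inr i)).
    exact: (leS (inr j)).
  have s1E : s1 = - 2 * s2 by lra.
  move: s1b; rewrite s1E normrM normrN (ger0_norm (ler0n _ 2)) -!mulrA.
  by have := normr_ge0 s2; lra.
have F1 s : F s 1 = 0.
  apply: (@gronwall R _ F dF 0 1 (1 + K * (m%:R * (m%:R * ((m%:R + 2) * B)))));
    last by rewrite lexx ler01.
  - by rewrite addr_ge0// !mulr_ge0.
  - by move=> i t /andP[t0 t1]; apply: Fd; rewrite !ltW.
  - move=> i; apply: derivable_within_continuous => t; rewrite in_itv/= => t01.
    by have := Fd i t t01 => d; exact: ex_derive.
  - case=> l; first by rewrite /F scale0r addr0 mul0r subr0 /X xi0 mxE.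
    rewrite /F /p /v mxE; apply/eqP; rewrite subr_eq0; apply/eqP; apply: eq_bigr => i _.
    by rewrite scale0r addr0 mxE.
  - exact: Fl.
apply/rowP => l; have /eqP := F1 (inl l).
by rewrite /F scale1r add0r mul1r subr_eq0 => /eqP.
Unshelve. all: by end_near. Qed.

End KillingChart.

(** * Uniqueness of geodesics in a coordinate domain *)

(** Multiplying by the metric cancels [invmx], so that Lipschitz bounds are needed only for the
    metric and its derivatives. *)
Lemma lower_geodesic_equation (R : realType) (m : nat) (G : 'M[R]_m)
  (C : 'I_m -> 'I_m -> 'I_m -> R) (a v : 'I_m -> R) :
  G \in unitmx -> G^T = G ->
  (forall k, a k + \sum_i \sum_j
     2^-1 * (\sum_l invmx G k l * C i j l) * v i * v j = 0) ->
  forall l, 2 * \sum_k a k * G k l + \sum_i \sum_j C i j l * (v i * v j) = 0.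
Proof.
move=> Gu GT eqa l.
pose Q : 'rV[R]_m := \row_l \sum_i \sum_j C i j l * (v i * v j).
pose A : 'rV[R]_m := \row_k a k.
have AE : A = - 2^-1 *: (Q *m invmx G).
  apply/rowP => k; rewrite !mxE; have := eqa k.
  have -> : \sum_i \sum_j 2^-1 * (\sum_l0 invmx G k l0 * C i j l0) * v i * v j =
      2^-1 * \sum_j Q 0 j * invmx G j k.
    have invC b : invmx G b k = invmx G k b by rewrite -{1}GT -trmx_inv mxE.
    transitivity (2^-1 * \sum_i \sum_j \sum_b C i j b * (v i * v j) * invmx G b k).
      rewrite mulr_sumr; apply: eq_bigr => i _; rewrite mulr_sumr; apply: eq_bigr => j _.
      rewrite -!mulrA; congr (_ * _); rewrite mulr_suml; apply: eq_bigr => b _.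
      by rewrite invC; ring.
    congr (_ * _); rewrite (eq_bigr (fun i => \sum_b \sum_j C i j b * (v i * v j) * invmx G b k)); last first.
      by move=> i _; rewrite exchange_big.
    rewrite exchange_big/=; apply: eq_bigr => b _; rewrite mxE mulr_suml.
    by apply: eq_bigr => i _; rewrite mulr_suml.
  by move=> E; lra.
have AG : A *m G = - 2^-1 *: Q by rewrite AE -scalemxAl -mulmxA mulVmx// mulmx1.
have -> : \sum_k a k * G k l = (A *m G) 0 l.
  by rewrite mxE; apply: eq_bigr => k _; rewrite mxE.
by rewrite AG !mxE; lra.
Qed.

Lemma ball_convex (R : realType) (m : nat) (q x y : 'rV[R]_m) (r s : R) :
  ball q r x -> ball q r y -> 0 <= s <= 1 -> ball q r (y + s *: (x - y)).
Proof.
rewrite -!ball_normE/= => qx qy /andP[s0 s1].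
have -> : q - (y + s *: (x - y)) = (1 - s) *: (q - y) + s *: (q - x).
  by apply/rowP => i; rewrite !mxE; ring.
rewrite (le_lt_trans (ler_normD _ _))// !normrZ !ger0_norm ?subr_ge0//.
(* Strictness is taken from the term of weight [1 - s], which is lost at [s = 1]. *)
have [->|sn1] := eqVneq s 1; first by rewrite subrr mul0r add0r mul1r.
have s1' : 0 < 1 - s by rewrite subr_gt0 lt_neqAle sn1.
rewrite (_ : r = (1 - s) * r + s * r); last by ring.
by rewrite ltr_leD// ?ltr_pM2l// ler_wpM2l// ltW.
Qed.

Lemma near_family_lipschitz (R : realType) (m : nat) (I : finType) (A : set 'rV[R]_m)
  (f : I -> 'rV[R]_m -> R) (q : 'rV[R]_m) : open A -> (forall i, Ck 1 A (f i)) -> A q ->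
  exists2 L, 0 <= L & exists2 r, 0 < r & forall i x y, ball q r x -> ball q r y ->
     `|f i x - f i y| <= L * `|x - y|.
Proof.
move=> oA Cf Aq.
have [|B B0 nB] := @near_family_bounded R _ (I * 'I_m)%type
    (fun p => 'D_('e_(p.2)) (f p.1)) q.
  by move=> p; exact: Ck_continuous (Ck_derive _ (Cf p.1)) Aq.
have /nbhs_ballP[r1 /= r10 Br1] : nbhs q A by exact: open_nbhs_nbhs.
move: nB => /nbhs_ballP[r2 /= r20 Br2].
exists (m%:R * B); first exact: mulr_ge0.
exists (Num.min r1 r2); first by rewrite lt_min r10.
move=> i x y qx qy.
have inA s : 0 <= s <= 1 -> A (y + s *: (x - y)).
  move=> s01; apply: Br1; apply: le_ball (ball_convex qx qy s01).
  by rewrite ge_min lexx.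
have [s /inA As|s s01] := @mean_value_segment R _ (f i) y (x - y).
  exact: Ck_derivable (Cf i) As.
rewrite (_ : y + (x - y) = x); last by rewrite addrC subrK.
move=> ->; rewrite (derive_sum_coord _ oA (Cf i) (inA _ s01)).
rewrite -mulrA; apply: norm_sum_le => j; rewrite normrM mulrC ler_pM ?coord_le_norm//.
apply: (Br2 _ _ (i, j)); apply: le_ball (ball_convex qx qy s01).
by rewrite ge_min lexx orbT.
Qed.

(** Position, velocity and acceleration are separate functions, which turns the geodesic equation
    into a first-order system for the first two. *)
Definition lower_geodesic_at (R : realType) (m : nat) (G : 'rV[R]_m -> 'M[R]_m)
    (f v a : R -> 'rV[R]_m) (t : R) :=
  [/\ is_derive t 1 f (v t), is_derive t 1 v (a t) &
      forall l, 2 * \sum_k a t 0 k * G (f t) k l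
        + \sum_i \sum_j christoffel_lower G i j l (f t) * (v t 0 i * v t 0 j) = 0].

Lemma Ck_christoffel_lower (R : realType) (m : nat) (U : set 'rV[R]_m)
  (G : 'rV[R]_m -> 'M[R]_m) k i j l : open U -> smooth U G ->
  Ck k U (christoffel_lower G i j l).
Proof.
move=> oU sG.
have Cdg h a b : Ck k U ('D_('e_h) (fun y => G y a b)).
  by apply: Ck_derive; exact: (Ck_mxP k.+1 G oU).1 (sG k.+1) a b.
have CN : Ck k U (cst (-1 : R) \* 'D_('e_l) (fun y => G y i j)).
  by apply: CkM => //; exact: Ck_cst.
apply: Ck_eq (CkD oU (CkD oU (Cdg i j l) (Cdg j i l)) CN) => // x _.
by rewrite /christoffel_lower /= mulN1r.
Qed.

(** Both equations are subtracted and Gronwall is applied to the differences of positions and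
    velocities. Since the metric multiplies the acceleration, an error a2 (G(f2) - G(f1)) remains;
    continuity of [a2] at [T] bounds it. *)
Lemma lower_geodesic_unique (R : realType) (m : nat) (U : set 'rV[R]_m)
  (G : 'rV[R]_m -> 'M[R]_m) (f1 v1 a1 f2 v2 a2 : R -> 'rV[R]_m) (T : R) :
  open U -> smooth U G ->
  (forall x, U x -> forall u, u != 0 -> 0 < bilin (G x) u u) ->
  U (f1 T) -> f1 T = f2 T -> v1 T = v2 T -> {for T, continuous a2} ->
  (\forall t \near T, lower_geodesic_at G f1 v1 a1 t) ->
  (\forall t \near T, lower_geodesic_at G f2 v2 a2 t) ->
  exists2 d, 0 < d & forall t, T <= t <= T + d -> f1 t = f2 t.
Proof.
move=> oU sG Gpos Uf f12 v12 ca2 n1 n2.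
set q := f1 T in Uf f12 *.
have cont (f v a : R -> 'rV[R]_m) : (\forall t \near T, lower_geodesic_at G f v a t) ->
    {for T, continuous f} /\ {for T, continuous v}.
  move=> /nbhs_singleton[df dv _]; split; apply: differentiable_continuous;
    apply/derivable1_diffP; exact: ex_derive.
have [cf1 cv1] := cont _ _ _ n1; have [cf2 cv2] := cont _ _ _ n2.
have [K K0 nK] := near_mulmx_lower_bound (Ck_continuous (sG 0%N) Uf)
  (posdef_unitmx (Gpos _ Uf)).
have [|L1 L10 [r1 r10 lip1]] := @near_family_lipschitz R m ('I_m * 'I_m * 'I_m)%type U
    (fun p => christoffel_lower G p.1.1 p.1.2 p.2) q oU _ Uf.
  by move=> p; exact: Ck_christoffel_lower.
have [|L2 L20 [r2 r20 lip2]] := @near_family_lipschitz R m ('I_m * 'I_m)%type U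
    (fun p y => G y p.1 p.2) q oU _ Uf.
  by move=> p; exact: (Ck_mxP 1 G oU).1 (sG 1%N) p.1 p.2.
have [|B B0 nB] := @near_family_bounded R _ ('I_m * 'I_m * 'I_m)%type
    (fun p => christoffel_lower G p.1.1 p.1.2 p.2) q.
  by move=> p; exact: Ck_continuous (Ck_christoffel_lower 0 _ _ _ oU sG) Uf.
have bnd (f : R -> 'rV[R]_m) : {for T, continuous f} ->
    exists2 V, 0 <= V & \forall t \near T, `|f t| <= V.
  move=> cf; exists (`|f T| + 1) => //.
  have /cvgrPdist_le/(_ _ ltr01) := cf; apply: filterS => t ft.
  by have -> : f t = f T - (f T - f t); [rewrite opprB addrC subrK|rewrite (le_trans (ler_normB _ _))// lerD].
have [V1 V10 nV1] := bnd _ cv1; have [V2 V20 nV2] := bnd _ cv2.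
have [V3 V30 nV3] := bnd _ ca2.
have nball (f : R -> 'rV[R]_m) r : {for T, continuous f} -> f T = q -> 0 < r ->
    \forall t \near T, ball q r (f t).
  by move=> cf <- r0; have /cvgrPdist_lt/(_ _ r0) := cf; apply: filterS => t; rewrite -ball_normE.
have nf1K : \forall t \near T, forall w : 'rV[R]_m, `|w| <= K * `|w *m G (f1 t)|.
  exact: cf1 _ nK.
have nf2B : \forall t \near T, forall p : 'I_m * 'I_m * 'I_m,
    `|christoffel_lower G p.1.1 p.1.2 p.2 (f2 t)| <= B.
  by move: nB; rewrite f12; exact: cf2.
have r12 : 0 < Num.min r1 r2 by rewrite lt_min r10.
have nb1 := nball f1 _ cf1 erefl r12.
have nb2 := nball f2 _ cf2 (esym f12) r12.
have : \forall t \near T, (lower_geodesic_at G f1 v1 a1 t /\ lower_geodesic_at G f2 v2 a2 t)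
  /\ ((`|v1 t| <= V1 /\ `|v2 t| <= V2) /\ `|a2 t| <= V3)
  /\ ((forall w : 'rV[R]_m, `|w| <= K * `|w *m G (f1 t)|) /\
    (forall p : 'I_m * 'I_m * 'I_m, `|christoffel_lower G p.1.1 p.1.2 p.2 (f2 t)| <= B))
  /\ (ball q (Num.min r1 r2) (f1 t) /\ ball q (Num.min r1 r2) (f2 t)).
  by do ![apply: filterI => //].
move=> /nbhs_ballP[d /= d0 Bd].
exists (d / 2); first by rewrite divr_gt0.
have inB (t : R) : T <= t <= T + d / 2 -> ball T d t.
  move=> /andP[t0 t1]; rewrite -ball_normE/= distrC ger0_norm ?subr_ge0//; lra.
pose F (s : 'I_m + 'I_m) (t : R) :=
  match s with inl l => f1 t 0 l - f2 t 0 l | inr l => v1 t 0 l - v2 t 0 l end.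
pose dF (s : 'I_m + 'I_m) (t : R) :=
  match s with inl l => v1 t 0 l - v2 t 0 l | inr l => a1 t 0 l - a2 t 0 l end.
pose S t := \sum_s `|F s t|.
have S0 t : 0 <= S t by exact: sumr_ge0.
have leS s t : `|F s t| <= S t by rewrite /S (bigD1 s)//= lerDl sumr_ge0.
have fS t : `|f1 t - f2 t| <= S t.
  by apply: norm_le_coord => // i j; rewrite ord1 !mxE; exact: (leS (inl j)).
have Fd s (t : R) : T <= t <= T + d / 2 -> is_derive t 1 (F s) (dF s t).
  move=> /inB/Bd[[[d1 e1 _] [d2 e2 _]] _].
  case: s => l /=.
    have := is_deriveB (derive_coord 0 l (@ex_derive _ _ _ _ _ _ _ d1))
                       (derive_coord 0 l (@ex_derive _ _ _ _ _ _ _ d2)).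
    by rewrite !derive_val.
  have := is_deriveB (derive_coord 0 l (@ex_derive _ _ _ _ _ _ _ e1))
                     (derive_coord 0 l (@ex_derive _ _ _ _ _ _ _ e2)).
  by rewrite !derive_val.
(* The first summand is the Lipschitz bound of the quadratic velocity term: [L1] from its
   coefficients, [B] from the velocities. The second pays for comparing the two metrics at different
   positions. *)
pose D := m%:R * (m%:R * (L1 * (V1 * V1) + B * (V1 + V2))) + 2 * (m%:R * (V3 * L2)).
have D0 : 0 <= D by rewrite addr_ge0// !mulr_ge0// addr_ge0// !mulr_ge0// addr_ge0.
have Fl s (t : R) : T < t < T + d / 2 -> `|dF s t| <= (1 + K * D) * S t.
  move=> /andP[t0 t1]; have tT : T <= t <= T + d / 2 by rewrite !ltW.
  have [[[_ _ E1] [_ _ E2]] [[[b1 b2] b3] [[Kt Bt] [q1 q2]]]] := Bd _ (inB _ tT).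
  rewrite mulrDl mul1r; case: s => l.
    by rewrite (le_trans (leS (inr l) t))// lerDl !mulr_ge0.
  pose w : 'rV[R]_m := a1 t - a2 t.
  have -> : dF (inr l) t = w 0 l by rewrite !mxE.
  rewrite (le_trans (coord_le_norm _ _ _))// (le_trans (Kt w))//.
  apply: (@le_trans _ _ (K * D * S t)); last by rewrite lerDr.
  rewrite -mulrA ler_wpM2l//.
  apply: norm_le_coord => [|a k]; first by rewrite !mulr_ge0.
  have {a}-> : (w *m G (f1 t)) a k = \sum_j a1 t 0 j * G (f1 t) j k
      - \sum_j a2 t 0 j * G (f2 t) j k
      + \sum_j a2 t 0 j * (G (f2 t) j k - G (f1 t) j k).
    rewrite mxE ord1 -sumrB -big_split/=; apply: eq_bigr => j _; rewrite !mxE; ring.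
  set s3 := \sum_j a2 t 0 j * (_ - _).
  have s3b : `|s3| <= m%:R * (V3 * L2) * S t.
    rewrite -!mulrA; apply: norm_sum_le => j; rewrite normrM ler_pM//.
      by rewrite (le_trans (coord_le_norm _ _ _)).
    have /(_ (j, k)) := lip2; rewrite distrC => l2.
    apply: (le_trans (l2 _ _ _ _)); last by rewrite ler_wpM2l.
      by apply: le_ball q1; rewrite ge_min lexx orbT.
    by apply: le_ball q2; rewrite ge_min lexx orbT.
  pose Q (f v : R -> 'rV[R]_m) :=
    \sum_i \sum_j christoffel_lower G i j k (f t) * (v t 0 i * v t 0 j).
  have e1 : 2 * \sum_j a1 t 0 j * G (f1 t) j k + Q f1 v1 = 0 := E1 k.
  have e2 : 2 * \sum_j a2 t 0 j * G (f2 t) j k + Q f2 v2 = 0 := E2 k.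
  have Qb : `|Q f1 v1 - Q f2 v2| <= m%:R * (m%:R * (L1 * (V1 * V1) + B * (V1 + V2))) * S t.
    rewrite -sumrB -!mulrA; apply: norm_sum_le => i; rewrite -sumrB.
    apply: norm_sum_le => j.
    rewrite (_ : _ * (v1 t 0 i * v1 t 0 j) - _ =
      (christoffel_lower G i j k (f1 t) - christoffel_lower G i j k (f2 t))
        * (v1 t 0 i * v1 t 0 j)
      + christoffel_lower G i j k (f2 t) * ((v1 t 0 i - v2 t 0 i) * v1 t 0 j
        + v2 t 0 i * (v1 t 0 j - v2 t 0 j))); last by ring.
    rewrite (_ : (L1 * (V1 * V1) + B * (V1 + V2)) * S t =
      L1 * S t * (V1 * V1) + B * (S t * V1 + V2 * S t)); last by ring.
    have v1b a : `|v1 t 0 a| <= V1 by rewrite (le_trans (coord_le_norm _ _ _)).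
    have v2b a : `|v2 t 0 a| <= V2 by rewrite (le_trans (coord_le_norm _ _ _)).
    have v12b a : `|v1 t 0 a - v2 t 0 a| <= S t by exact: (leS (inr a)).
    rewrite (le_trans (ler_normD _ _))// lerD//.
      rewrite normrM ler_pM//; last by rewrite normrM ler_pM.
      apply: (le_trans (lip1 (i, j, k) _ _ _ _)); last by rewrite ler_wpM2l.
        by apply: le_ball q1; rewrite ge_min lexx.
      by apply: le_ball q2; rewrite ge_min lexx.
    rewrite normrM ler_pM//; first exact: (Bt (i, j, k)).
    by rewrite (le_trans (ler_normD _ _))// !normrM lerD// ler_pM.
  have DS : D * S t = m%:R * (m%:R * (L1 * (V1 * V1) + B * (V1 + V2))) * S t
      + 2 * (m%:R * (V3 * L2) * S t) by rewrite /D; ring.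
  have := le_trans (normr_ge0 _) Qb; have := le_trans (normr_ge0 _) s3b.
  move: Qb s3b; rewrite DS !ler_norml.
  move: (m%:R * _ * S t) (m%:R * (V3 * L2) * S t) e1 e2.
  move: (\sum_j a1 t 0 j * _) (\sum_j a2 t 0 j * G _ _ _) => s1 s2 x y e1 e2.
  by move=> /andP[? ?] /andP[? ?] ? ?; apply/andP; split; lra.
have F0 s t : T <= t <= T + d / 2 -> F s t = 0.
  move=> tT; apply: (@gronwall R _ F dF T (T + d / 2) (1 + K * D)) tT.
  - by rewrite addr_ge0// mulr_ge0.
  - by move=> i u /andP[t0 t1]; apply: Fd; rewrite !ltW.
  - move=> i; apply: derivable_within_continuous => u; rewrite in_itv/= => u01.
    by have := Fd i u u01 => e; exact: ex_derive.
  - by case=> l; rewrite /F ?v12 -?f12 subrr.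
  - exact: Fl.
move=> t tT; apply/rowP => l; apply/eqP; rewrite -subr_eq0; apply/eqP.
exact: (F0 (inl l) t tT).
Qed.

(** * Geodesics and normal coordinates on a manifold *)

Lemma near_ballI (R : realType) (V : pseudoMetricType R) (x : V) (P Q : set V) :
  (\forall y \near x, P y) -> (\forall y \near x, Q y) ->
  exists2 e : R, 0 < e & forall y, ball x e y -> P y /\ Q y.
Proof.
move=> nP nQ; have /nbhs_ballP[e e0 Be] : nbhs x (P `&` Q) by exact: filterI.
by exists e.
Qed.

Lemma derive1_fun (R : realType) (W : normedModType R) (f : R -> W) : (derive1 f) = 'D_1 f.
Proof. by apply/funext => t; rewrite derive1E. Qed.

(** Both derivatives are limits of left quotients alone. At the supremum of an interval of
    agreement, nothing is known yet to the right. *)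
Lemma left_derive1_eq (R : realType) (W : normedModType R) (f h : R -> W) (a T : R) :
  a < T -> derivable f T 1 -> derivable h T 1 ->
  (forall t, a <= t <= T -> f t = h t) -> (derive1 f) T = (derive1 h) T.
Proof.
move=> aT df dh fh; rewrite !derive1E /derive.
rewrite (cvg_at_leftE _ _ df) (cvg_at_leftE _ _ dh).
have fhT : f T = h T by apply: fh; rewrite lexx ltW.
have nE : \forall u \near (0 : R)^'-, u^-1 *: ((f \o shift T) (u *: 1) - f T) =
    u^-1 *: ((h \o shift T) (u *: 1) - h T).
  near=> u; rewrite /= fhT fh//= [u%:A]mulr1; apply/andP; split.
    by rewrite -lerBlDr; near: u; apply: nbhs_left_ge; rewrite subr_lt0.
  by rewrite gerDr; near: u; exact: nbhs_left_le.
congr (lim _); rewrite eqEsubset; split; apply: near_eq_cvg.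
  exact: nE.
by apply: filterS nE => u /esym.
Unshelve. all: by end_near. Qed.

Section ChartTheory.
Context {R : realType} {m : nat} {M : manifold R m}.
Implicit Types (c d : chart R m M) (p q : M).

Lemma cdom_open c : atlas c -> open (cdom c).
Proof. by move=> /atlas_chart[]. Qed.

Lemma ccod_open c : atlas c -> open (ccod c).
Proof. by move=> /atlas_chart[]. Qed.

Lemma crdK c p : atlas c -> cdom c p -> cinv c (crd c p) = p.
Proof. by move=> /atlas_chart[_ _ cK _ _] cp; apply: cK; rewrite inE. Qed.

Lemma ccod_crd c p : cdom c p -> ccod c (crd c p).
Proof. by move=> cp; exists p. Qed.

Lemma cinvP c y : atlas c -> ccod c y -> cdom c (cinv c y) /\ crd c (cinv c y) = y.
Proof. by move=> ac [p cp <-]; rewrite crdK. Qed.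

Lemma crd_continuous c p : atlas c -> cdom c p -> {for p, continuous (crd c)}.
Proof. by move=> /atlas_chart[_ _ _ cc _] cp; apply: cc; rewrite inE. Qed.

Lemma cinv_continuous c y : atlas c -> ccod c y -> {for y, continuous (cinv c)}.
Proof. by move=> /atlas_chart[_ _ _ _ cc] cy; apply: cc; rewrite inE. Qed.

End ChartTheory.

Section Geodesics.
Context {R : realType} {m : nat} {M : manifold R m}.
Variable g : riemannian_metric M.
Implicit Types (c d : chart R m M) (p q : M) (s : R -> M) (J : set R).

Definition chart_metric c (y : 'rV[R]_m) : 'M[R]_m := g c (cinv c y).

Lemma chart_metric_smooth c : atlas c -> smooth (ccod c) (chart_metric c).
Proof. by move=> ac; exact: gcomp_smooth. Qed.

Lemma chart_metric_sym c y : atlas c -> ccod c y -> (chart_metric c y)^T = chart_metric c y.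
Proof. by move=> ac /(cinvP ac)[cy _]; exact: gcomp_sym. Qed.

Lemma chart_metric_pos c y : atlas c -> ccod c y ->
  forall u, u != 0 -> 0 < bilin (chart_metric c y) u u.
Proof. by move=> ac /(cinvP ac)[cy _]; exact: gcomp_pos. Qed.

(* Geodesics up to the regularity and in the form (without inverse of the
   metric) needed for uniqueness; unlike [geodesic], visibly stable under
   linear reparametrisation. *)
Definition pre_geodesic J s :=
  [/\ open J, {in J, continuous s} &
    forall c t, atlas c -> J t -> cdom c (s t) ->
      let f := crd c \o s in
      {for t, continuous (derive1 (derive1 f))} /\
      lower_geodesic_at (chart_metric c) f (derive1 f) (derive1 (derive1 f)) t].

Lemma geodesic_pre J s : geodesic g J s -> pre_geodesic J s.
Proof.
move=> [[oJ cs ss] eqs]; split; [exact: oJ|exact: cs|move=> c t ac Jt cst f].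
have At : (J `&` s @^-1` cdom c) t by split.
have C3 := ss c ac 3%N; rewrite -/f in C3.
have E1 : (derive1 f) = 'D_1 f by exact: derive1_fun.
have E2 : (derive1 (derive1 f)) = 'D_1 ('D_1 f) by rewrite -E1; exact: derive1_fun.
have C2 := Ck_derive (1 : R) C3; have C1 := Ck_derive (1 : R) C2.
split; first by rewrite E2; exact: Ck_continuous C1 At.
split.
- by rewrite E1; exact: derivableP (Ck_derivable C3 At).
- by rewrite E2 E1; exact: derivableP (Ck_derivable C2 At).
have cf : ccod c (f t) by exact: ccod_crd.
have Gu := posdef_unitmx (chart_metric_pos ac cf).
exact: (lower_geodesic_equation Gu (chart_metric_sym ac cf) (eqs c t ac Jt cst)).
Qed.

Lemma pre_geodesic_open J s c : atlas c -> pre_geodesic J s ->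
  open (J `&` s @^-1` cdom c).
Proof.
move=> ac [oJ cs _]; rewrite openE => t [Jt ct]; apply: filterI.
  exact: open_nbhs_nbhs.
apply: cs; first by rewrite inE.
by apply: open_nbhs_nbhs; split => //; exact: cdom_open.
Qed.

(** The velocity is multiplied by [k] and the acceleration by [k ^+ 2], and the equation is
    quadratic in the velocity. *)
Lemma pre_geodesic_scale (k : R) J s : pre_geodesic J s ->
  pre_geodesic [set t | J (k * t)] (fun t => s (k * t)).
Proof.
move=> gs; have [oJ cs eqs] := gs.
have ck : continuous (fun t : R => k * t) by exact: mulrl_continuous.
split.
- exact: (open_comp (fun t _ => ck t) oJ).
- move=> t; rewrite inE/= => Jt.
  by apply: (@continuous_comp _ _ _ _ s t); [exact: ck|apply: cs; rewrite inE].
move=> c t ac Jt cst h.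
pose f := crd c \o s.
have nA : \forall u \near t, J (k * u) /\ cdom c (s (k * u)).
  have oA := open_comp (fun t _ => ck t) (pre_geodesic_open ac gs).
  by apply: (open_nbhs_nbhs (conj oA _)).
have dk (u : R) : is_derive u 1 (fun t : R => k * t) k.
  by apply: is_derive_eq; rewrite [X in X = _]mulr1.
have fd (u : R) : J (k * u) /\ cdom c (s (k * u)) -> is_derive u 1 h (k *: (derive1 f) (k * u)).
  move=> [Ju cu]; have [_ [d1 _ _]] := eqs c _ ac Ju cu.
  exact: is_derive1_comp d1 (dk u).
have n1 : \forall u \near t, k *: (derive1 f) (k * u) = (derive1 h) u.
  by apply: filterS nA => u /fd [_ <-]; rewrite derive1E.
have fdd (u : R) : J (k * u) /\ cdom c (s (k * u)) ->
    is_derive u 1 (fun u => k *: (derive1 f) (k * u)) (k *: (k *: (derive1 (derive1 f)) (k * u))).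
  move=> [Ju cu]; have [_ [_ d2 _]] := eqs c _ ac Ju cu.
  apply: is_deriveZ; exact: (is_derive1_comp d2 (dk u)).
have n2 : \forall u \near t, k *: (k *: (derive1 (derive1 f)) (k * u)) = (derive1 (derive1 h)) u.
  have : \forall u \near t, \forall w \near u, k *: (derive1 f) (k * w) = (derive1 h) w.
    exact: nbhs_interior n1.
  apply: filterS2 nA => u /fdd[_ <-] e; rewrite derive1E.
  exact: near_eq_derive e.
have [cf [d1 d2 eqf]] := eqs c _ ac Jt cst.
have Nt : J (k * t) /\ cdom c (s (k * t)) by [].
split.
  suff H : (fun u => k *: (k *: (derive1 (derive1 f)) (k * u))) @ t
      --> derive1 (derive1 h) t by apply: cvg_trans H; exact: near_eq_cvg n2.
  have <- := nbhs_singleton n2.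
  apply: cvgZl_tmp; apply: cvgZl_tmp.
  by apply: (@continuous_comp _ _ _ _ (derive1 (derive1 f)) t); [exact: ck|exact: cf].
split.
- by rewrite -(nbhs_singleton n1); exact: fd.
- rewrite -(nbhs_singleton n2); apply: near_eq_is_derive n1 _; exact: fdd.
move=> l; rewrite -(nbhs_singleton n1) -(nbhs_singleton n2).
rewrite -[RHS](mulr0 (k ^+ 2)) -[X in _ = _ * X](eqf l) mulrDr; congr (_ + _).
  rewrite mulrCA; congr (_ * _); rewrite mulr_sumr; apply: eq_bigr => a _.
  by rewrite !mxE; ring.
rewrite mulr_sumr; apply: eq_bigr => a _; rewrite mulr_sumr; apply: eq_bigr => b _.
by rewrite !mxE; ring.
Qed.

Let geodesic_extend J1 J2 s1 s2 c (T : R) :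
  pre_geodesic J1 s1 -> pre_geodesic J2 s2 -> J1 T -> J2 T ->
  atlas c -> cdom c (s1 T) -> s1 T = s2 T ->
  derive1 (crd c \o s1) T = derive1 (crd c \o s2) T ->
  exists2 d, 0 < d & forall t, T <= t <= T + d -> s1 t = s2 t.
Proof.
move=> g1 g2 J1T J2T ac c1 s12 d12.
have c2 : cdom c (s2 T) by rewrite -s12.
have near_geo J s : pre_geodesic J s -> J T -> cdom c (s T) ->
    \forall t \near T, cdom c (s t) /\ lower_geodesic_at (chart_metric c) (crd c \o s)
       (derive1 (crd c \o s)) (derive1 (derive1 (crd c \o s))) t.
  move=> gs JT cT; have [_ _ eqs] := gs.
  have : \forall t \near T, (J `&` s @^-1` cdom c) t.
    by apply: open_nbhs_nbhs; split; [exact: pre_geodesic_open|split].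
  by apply: filterS => t [Jt ct]; split; [exact: ct|exact: (eqs c t ac Jt ct).2].
have n1 := near_geo _ _ g1 J1T c1; have n2 := near_geo _ _ g2 J2T c2.
have [_ _ eq2] := g2; have [cont2 _] := eq2 c T ac J2T c2.
have [d d0 Hd] := @lower_geodesic_unique R m (ccod c) (chart_metric c)
  (crd c \o s1) (derive1 (crd c \o s1)) (derive1 (derive1 (crd c \o s1)))
  (crd c \o s2) (derive1 (crd c \o s2)) (derive1 (derive1 (crd c \o s2))) T
  (ccod_open ac) (chart_metric_smooth ac) (fun x => @chart_metric_pos c x ac)
  (ccod_crd c1) (congr1 (crd c) s12) d12 cont2
  (filterS (fun t => @proj2 _ _) n1) (filterS (fun t => @proj2 _ _) n2).
have [e e0 Be] := near_ballI n1 n2.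
exists (Num.min d (e / 2)); first by rewrite lt_min d0 divr_gt0.
move=> t /andP[t0 t1].
have /Be[[ct1 _] [ct2 _]] : ball T e t.
  rewrite -ball_normE/= distrC ger0_norm ?subr_ge0//.
  have : Num.min d (e / 2) <= e / 2 by rewrite ge_min lexx orbT.
  by move: (Num.min _ _) t1 => z; lra.
rewrite -(crdK ac ct1) -(crdK ac ct2); congr (cinv c _); apply: Hd.
rewrite t0 (le_trans t1)// lerD2l ge_min lexx//.
Qed.

(** Neighbourhoods of the two endpoints always meet, at a common value of the curves just before
    [b]; the Hausdorff property then identifies the endpoints. *)
Lemma eq_left_limit (T : topologicalType) (s1 s2 : R -> T) (a b : R) :
  hausdorff_space T -> a < b -> {for b, continuous s1} -> {for b, continuous s2} ->
  (forall t, a <= t < b -> s1 t = s2 t) -> s1 b = s2 b.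
Proof.
move=> hT ab c1 c2 s12; apply: hT => A B nA nB.
have n1 : \forall t \near b, A (s1 t) by exact: c1.
have n2 : \forall t \near b, B (s2 t) by exact: c2.
have [e e0 Be] := near_ballI n1 n2.
pose t := Num.max a (b - e / 2).
have tb : t < b by rewrite gt_max ab ltrBlDr ltrDl divr_gt0.
have [At Bt] : A (s1 t) /\ B (s2 t).
  apply: Be; rewrite -ball_normE/= ger0_norm ?subr_ge0 ?ltW//.
  have : b - e / 2 <= t by rewrite le_max lexx orbT.
  by move: t tb => t; lra.
exists (s1 t); split; first exact: At.
by rewrite s12 ?tb ?andbT// le_max lexx.
Qed.

(** Let [T] be the supremum of the times up to which the curves agree. Their values agree at [T] by
    the Hausdorff property, their velocities as left derivatives, and local uniqueness carries the
    agreement past [T]; so [T] cannot be below 1. *)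
Lemma geodesic_unique J1 J2 s1 s2 c :
  pre_geodesic J1 s1 -> pre_geodesic J2 s2 ->
  (forall t, 0 <= t <= 1 -> J1 t) -> (forall t, 0 <= t <= 1 -> J2 t) ->
  s1 0 = s2 0 -> atlas c -> cdom c (s1 0) ->
  derive1 (crd c \o s1) 0 = derive1 (crd c \o s2) 0 ->
  forall t, 0 <= t <= 1 -> s1 t = s2 t.
Proof.
move=> g1 g2 J1s J2s s120 ac c0 d120.
pose E := [set t : R | 0 <= t <= 1 /\ forall u, 0 <= u <= t -> s1 u = s2 u].
have E0 : E 0.
  by split=> [|u]; [rewrite lexx ler01|rewrite -eq_le => /eqP <-].
have Eub : ubound E 1 by move=> t [/andP[]].
have supE : has_sup E by split; [exists 0|exists 1].
pose T := sup E.
have T0 : 0 <= T by exact: sup_upper_bound supE _ E0.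
have T1 : T <= 1 by apply: ge_sup => //; exists 0.
have ltT u : 0 <= u < T -> s1 u = s2 u.
  move=> /andP[u0 uT]; have [t [_ Et] ut] := @sup_gt R E u (ex_intro _ 0 E0) uT.
  by apply: Et; rewrite u0 ltW.
have T01 : 0 <= T <= 1 by rewrite T0.
have [oJ1 cs1 eq1] := g1; have [oJ2 cs2 eq2] := g2.
have s12T : s1 T = s2 T.
  have [<-//|Tn0] := eqVneq 0 T.
  apply: (@eq_left_limit _ s1 s2 0 T) => //.
  - exact: manifold_hausdorff.
  - by rewrite lt_neqAle Tn0.
  - by apply: cs1; rewrite inE; exact: J1s.
  - by apply: cs2; rewrite inE; exact: J2s.
(* At [T = 0] equality of velocities is the hypothesis, in the chart [c]; for [T > 0] any chart
   around [s1 T] serves. *)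
have [d ad [dT dd]] : exists2 d, atlas d & cdom d (s1 T) /\
    derive1 (crd d \o s1) T = derive1 (crd d \o s2) T.
  have [<-|Tn0] := eqVneq 0 T; first by exists c.
  have [d ad dT] := atlas_cover (s1 T); exists d; [exact: ad|split; first exact: dT].
  have [_ [i1 _ _]] := eq1 d T ad (J1s T T01) dT.
  rewrite s12T in dT; have [_ [i2 _ _]] := eq2 d T ad (J2s T T01) dT.
  apply: (@left_derive1_eq _ _ _ _ 0) => //; first by rewrite lt_neqAle Tn0.
  move=> t /andP[t0]; rewrite le_eqVlt => /predU1P[->|tT]; rewrite /= ?s12T//.
  by rewrite ltT// t0.
have [e e0 He] := geodesic_extend g1 g2 (J1s T T01) (J2s T T01) ad dT s12T dd.
have eqTe u : 0 <= u <= T + e -> s1 u = s2 u.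
  move=> /andP[u0 uTe]; have [uT|Tu] := ltP u T; first by apply: ltT; rewrite u0.
  by apply: He; rewrite Tu.
have T1' : 1 <= T.
  rewrite leNgt; apply/negP => T1'.
  have : Num.min 1 (T + e) <= T.
    apply: (sup_upper_bound supE); split.
      apply/andP; split; last by rewrite ge_min lexx.
      by rewrite le_min ler01 addr_ge0// ltW.
    by move=> u /andP[u0]; rewrite le_min => /andP[_ ue]; apply: eqTe; rewrite u0.
  by rewrite ge_min !leNgt T1' ltrDl e0.
move=> t /andP[t0 t1]; apply: eqTe; rewrite t0 (le_trans t1)//.
by rewrite (le_trans T1')// lerDl ltW.
Qed.

End Geodesics.

(** * Rays in normal coordinates *)

Section NormalCoordinates.
Context {R : realType} {m : nat} {M : manifold R m}.
Variable g : riemannian_metric M.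

Let interval01 (I : set R) : is_interval I -> I 0 -> I 1 ->
  forall t, 0 <= t <= 1 -> I t.
Proof. by move=> iI I0 I1 t t01; exact: (iI 0 1). Qed.

(** The geodesic [s] of [x], run at speed [t], and the geodesic [s'] of [t *: x] have the same
    initial point and velocity. Hence they agree at time 1, where one is at [s t] and the other at
    the point with coordinates [t *: x]. *)
Lemma normal_chart_ray (p : M) (c : chart R m M) : normal_chart g p c ->
  exists2 r : R, 0 < r & forall x, ball 0 r x ->
    exists I s, [/\ geodesic g I s, forall t, 0 <= t <= 1 -> I t &
      forall t, 0 <= t <= 1 -> ccod c (t *: x) /\ s t = cinv c (t *: x)].
Proof.
move=> [ac cp cp0 [E frE expE]].
have c0 : ccod c 0 by rewrite -cp0; exact: ccod_crd.
have /nbhs_ballP[r /= r0 Br] : nbhs (0 : 'rV[R]_m) (ccod c).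
  by apply: open_nbhs_nbhs; split => //; exact: ccod_open.
exists r => // x xr.
have xB t : 0 <= t <= 1 -> ccod c (t *: x).
  move=> /andP[t0 t1]; apply: Br; move: xr; rewrite -!ball_normE/= !sub0r !normrN.
  by rewrite normrZ ger0_norm//; apply: le_lt_trans; rewrite ler_piMl.
have cx : ccod c x by exact: Br.
have [I [s [iI I0 I1 gs [s0 s1 sE]]]] : is_exp g p (fun d => \sum_i x 0 i *: E i d) (cinv c x).
  by apply: expE; rewrite inE.
exists I, s; split; [exact: gs|exact: interval01|].
move=> t t01; split; first exact: xB.
have [I' [s' [iI' I'0 I'1 gs' [s'0 s'1 s'E]]]] :
    is_exp g p (fun d => \sum_i (t *: x) 0 i *: E i d) (cinv c (t *: x)).
  by apply: expE; rewrite inE; exact: xB.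
have ps := geodesic_pre gs; have pst := pre_geodesic_scale t ps.
have ps' := geodesic_pre gs'.
rewrite -s'1 -[in LHS](mulr1 t).
have i11 : 0 <= (1 : R) <= 1 by rewrite ler01 lexx.
apply: (geodesic_unique pst ps' _ (interval01 iI' I'0 I'1) _ ac _ _ i11).
- move=> u /andP[u0 u1]; apply: (interval01 iI I0 I1).
  case/andP: t01 => t0 t1; rewrite mulr_ge0//= (le_trans _ t1)//.
  by rewrite ler_piMr.
- by rewrite mulr0 s0 s'0.
- by rewrite mulr0 s0.
have cs0 : cdom c (s 0) by rewrite s0.
have [_ _ eqs] := ps; have [_ [d1 _ _]] := eqs c 0 ac I0 cs0.
have dt : is_derive (0 : R) 1 (fun u : R => t * u) t.
  by apply: is_derive_eq; rewrite [X in X = _]mulr1.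
have d1t : is_derive (t * 0) 1 (crd c \o s) (derive1 (crd c \o s) 0) by rewrite mulr0.
have [_ dE] := is_derive1_comp d1t dt.
rewrite derive1E; have -> : derive1 (crd c \o s') 0 = t *: derive1 (crd c \o s) 0.
  have -> : derive1 (crd c \o s') 0 = crd_derive c s' 1 0 by [].
  have -> : derive1 (crd c \o s) 0 = crd_derive c s 1 0 by [].
  rewrite s'E// sE// scaler_sumr; apply: eq_bigr => i _.
  by rewrite mxE scalerA.
exact: dE.
Qed.

(** A ray is affine in the chart: its second derivative vanishes, and the geodesic equation reduces
    to its quadratic term. *)
Lemma normal_chart_christoffel (p : M) (c : chart R m M) : normal_chart g p c ->
  \forall y \near (0 : 'rV[R]_m), forall k,
    \sum_i \sum_j christoffel_lower (chart_metric g c) i j k y * (y 0 i * y 0 j) = 0.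
Proof.
move=> nc; have [ac _ _ _] := nc.
have [r r0 ray] := normal_chart_ray nc.
apply/nbhs_ballP; exists (r / 2); first by rewrite /= divr_gt0.
move=> y /= yr k.
(* The ray of [2 *: y] meets [y] at time 1/2, inside [0, 1], where two-sided derivatives can be
   computed. Its velocity [2 *: y] causes the factor 4 cancelled at the end. *)
have xr : ball (0 : 'rV[R]_m) r (2 *: y).
  move: yr; rewrite -!ball_normE/= !sub0r !normrN normrZ ger0_norm//; lra.
have [I [s [gs I01 sE]]] := ray _ xr.
have [_ _ eqs] := geodesic_pre gs.
have h01 : 0 <= (2^-1 : R) <= 1 by apply/andP; split; lra.
pose f := crd c \o s.
have fE t : 0 <= t <= 1 -> f t = t *: (2 *: y).
  by move=> /sE[cy st]; rewrite /f /= st (cinvP ac cy).2.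
have [ch sh] := sE _ h01.
have cs : cdom c (s 2^-1) by rewrite sh; exact: (cinvP ac ch).1.
have [_ [_ _ /(_ k)]] := eqs c _ ac (I01 _ h01) cs.
have nf (t : R) : 0 < t < 1 -> \forall u \near t, u *: (2 *: y) = f u.
  move=> t01; near=> u; rewrite fE//.
  have : u \in `]0, 1[%R by near: u; exact: near_in_itvoo.
  by rewrite in_itv/= => /andP[u0 u1]; rewrite !ltW.
have df (t : R) : 0 < t < 1 -> derive1 f t = 2 *: y.
  move=> t01; rewrite derive1E -(near_eq_derive _ (nf t t01)).
  have d : is_derive t 1 (fun u : R => u *: (2 *: y)) (2 *: y).
    have -> : (fun u : R => u *: (2 *: y)) = (fun u => id (0 + u *: (2 *: y))).
      by apply/funext => u; rewrite /= add0r.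
    have := @is_derive_line R _ _ id 0 (2 *: y) t (@derivable_id _ _ _ _).
    by rewrite derive_id.
  by case: d.
have h01' : 0 < (2^-1 : R) < 1 by apply/andP; split; lra.
have nh : \forall u \near (2^-1 : R), (2 *: y) = derive1 f u.
  near=> u; rewrite df//.
  have : u \in `]0, 1[%R by near: u; exact: near_in_itvoo.
  by rewrite in_itv.
have ddf : derive1 (derive1 f) 2^-1 = 0.
  by rewrite derive1E -(near_eq_derive _ nh) derive_cst.
rewrite -/f ddf df// (fE _ h01) scalerA mulVf// scale1r.
rewrite big1 => [|a _]; last by rewrite mxE mul0r.
rewrite mulr0 add0r => E.
apply: (@mulfI _ 4); rewrite ?mulr0//.
rewrite -[RHS]E mulr_sumr; apply: eq_bigr => i _; rewrite mulr_sumr; apply: eq_bigr => j _.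
by rewrite !mxE; ring.
Unshelve. all: by end_near. Qed.

End NormalCoordinates.

(** * Higher derivatives along curves *)

Lemma smooth_derive (R : realType) (V W : normedModType R) (A : set V) (f : V -> W) v :
  smooth A f -> smooth A ('D_v f).
Proof. by move=> sf k; exact: Ck_derive. Qed.

Lemma smooth_derive1 (R : realType) (W : normedModType R) (I : set R) (f : R -> W) :
  smooth I f -> smooth I (derive1 f).
Proof. by rewrite derive1_fun; exact: smooth_derive. Qed.

Lemma smooth_is_derive1 (R : realType) (W : normedModType R) (I : set R) (f : R -> W) t :
  smooth I f -> I t -> is_derive t 1 f (derive1 f t).
Proof.
by move=> sf It; rewrite derive1E; exact: derivableP (Ck_derivable (sf 1%N) It).
Qed.

Lemma smooth_coord (R : realType) (V : normedModType R) (A : set V) (p q : nat)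
  (F : V -> 'M[R]_(p, q)) i j : open A -> smooth A F -> smooth A (fun x => F x i j).
Proof. by move=> oA sF k; exact: (Ck_mxP k F oA).1 (sF k) i j. Qed.

Lemma smoothM (R : realType) (V : normedModType R) (A : set V) (f g : V -> R) :
  open A -> smooth A f -> smooth A g -> smooth A (fun x => f x * g x).
Proof. by move=> oA sf sg k; exact: CkM. Qed.

Lemma derive1n_near_eq (R : realType) (W : normedModType R) k (f h : R -> W) (t : R) :
  (\forall u \near t, f u = h u) -> derive1n k f t = derive1n k h t.
Proof.
elim: k f h => [|k IH] f h fh; first exact: nbhs_singleton fh.
rewrite !derive1Sn; apply: IH.
have : \forall u \near t, \forall w \near u, f w = h w by exact: nbhs_interior fh.
by apply: filterS => u e; rewrite !derive1E; exact: near_eq_derive e.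
Qed.

Lemma derive1n_eq_on (R : realType) (W : normedModType R) k (f h : R -> W) (I : set R) (t : R) :
  open I -> I t -> (forall u, I u -> f u = h u) -> derive1n k f t = derive1n k h t.
Proof.
move=> oI It fh; apply: derive1n_near_eq.
by apply: filterS (open_nbhs_nbhs (conj oI It)) => u /fh.
Qed.

Lemma derive1n_coord (R : realType) (p q : nat) (I : set R) (F : R -> 'M[R]_(p, q))
  k (t : R) i j : open I -> smooth I F -> I t ->
  derive1n k F t i j = derive1n k (fun u => F u i j) t.
Proof.
move=> oI; elim: k F => [|k IH] F sF It //.
rewrite !derive1Sn IH//; last exact: smooth_derive1.
apply: derive1n_eq_on oI It _ => u Iu.
rewrite !derive1E; have [_ ->] := derive_coord i j (Ck_derivable (v := (1 : R)) (sF 1%N) Iu).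
by [].
Qed.

Lemma derive1n_linear (R : realType) (n : nat) (I : set R) (u : 'I_n -> R -> R)
  (a : 'I_n -> R) k (t : R) : open I -> (forall j, smooth I (u j)) -> I t ->
  derive1n k (fun t => \sum_j u j t * a j) t = \sum_j derive1n k (u j) t * a j.
Proof.
move=> oI; elim: k u => [|k IH] u su It //.
rewrite derive1Sn; under [RHS]eq_bigr do rewrite derive1Sn.
rewrite -IH//; last by move=> j; exact: smooth_derive1.
apply: derive1n_eq_on oI It _ => w Iw; rewrite derive1E.
have [] // : is_derive w 1 (fun t => \sum_j u j t * a j) (\sum_j derive1 (u j) w * a j).
apply: is_derive_sumr => j.
have H := is_deriveM (smooth_is_derive1 (su j) Iw) (is_derive_cst (a j) w 1).
refine (@is_derive_eq _ _ _ _ _ _ _ _ H _).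
by rewrite scaler0 add0r /GRing.scale/= mulrC.
Qed.

(** The induction varies [f]: the derivative of [f \o u] is a sum of products of derivatives of [u]
    with composites of partial derivatives of [f]. *)
Lemma smooth_comp_curve (R : realType) (m : nat) (A : set 'rV[R]_m)
  (f : 'rV[R]_m -> R) (I : set R) (u : R -> 'rV[R]_m) :
  open A -> open I -> smooth A f -> smooth I u -> (forall t, I t -> A (u t)) ->
  smooth I (f \o u).
Proof.
move=> oA oI sf su Iu k; elim: k f sf => [|k IH] f sf.
  split => // t; rewrite inE => It; apply: continuous_comp.
    exact: Ck_continuous (su 0%N) It.
  exact: Ck_continuous (sf 0%N) (Iu _ It).
have d t : I t -> is_derive t 1 (f \o u)
    (\sum_i derive1 u t 0 i * 'D_('e_i) f (u t)).
  move=> It; apply: (is_derive_curve oA (sf 1%N) (Iu t It)).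
  exact: smooth_is_derive1.
split.
  move=> t; rewrite inE => /d[dfu _].
  exact/differentiable_continuous/derivable1_diffP.
move=> v; have vE : v = v *: (1 : R) by rewrite [RHS]mulr1.
have dv t : I t -> is_derive t v (f \o u)
    (v * \sum_i derive1 u t 0 i * 'D_('e_i) f (u t)).
  by move=> /d[dfu <-]; rewrite {1}vE; exact: is_derive_scale.
split; first by move=> t; rewrite inE => /dv[].
have C : Ck k I ((fun=> v) \* (fun t => \sum_i derive1 u t 0 i * ('D_('e_i) f \o u) t)).
  apply: CkM => //; first exact: Ck_cst.
  apply: Ck_sum => // i; apply: CkM => //.
    exact: (smooth_coord 0 i oI (smooth_derive1 su) k).
  by apply: IH; exact: smooth_derive.
by apply: Ck_eq C => // t; rewrite inE => /dv[_ ->].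
Qed.

Definition contact (R : realType) (W : normedModType R) k (t : R) (u w : R -> W) :=
  forall l, (l <= k)%N -> derive1n l u t = derive1n l w t.

Lemma contactS (R : realType) (W : normedModType R) k (t : R) (u w : R -> W) :
  contact k.+1 t u w -> contact k t u w.
Proof. by move=> c l lk; apply: c; rewrite leqW. Qed.

Lemma contact_derive1 (R : realType) (W : normedModType R) k (t : R) (u w : R -> W) :
  contact k.+1 t u w -> contact k t (derive1 u) (derive1 w).
Proof. by move=> c l lk; rewrite -!derive1Sn; exact: c. Qed.

(** Leibniz' rule without binomials: the derivative of a sum of products is a sum of products over
    [J * bool], the flag telling which factor is differentiated. *)
Lemma derive1n_sum_mul_contact (R : realType) (I : set R) (t0 : R) k : open I -> I t0 ->
  forall (J : finType) (b c b' c' : J -> R -> R),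
  (forall j, [/\ smooth I (b j), smooth I (c j), smooth I (b' j) & smooth I (c' j)]) ->
  (forall j, contact k t0 (b j) (b' j)) -> (forall j, contact k t0 (c j) (c' j)) ->
  derive1n k (fun t => \sum_j b j t * c j t) t0 =
  derive1n k (fun t => \sum_j b' j t * c' j t) t0.
Proof.
move=> oI It0; elim: k => [|k IH] J b c b' c' sm cb cc.
  by apply: eq_bigr => j _; congr (_ * _); [exact: (cb j 0%N)|exact: (cc j 0%N)].
pose B (f : J -> R -> R) (j : J * bool) := if j.2 then derive1 (f j.1) else f j.1.
pose C (f : J -> R -> R) (j : J * bool) := if j.2 then f j.1 else derive1 (f j.1).
have step (f h : J -> R -> R) : (forall j, smooth I (f j)) -> (forall j, smooth I (h j)) ->
    derive1n k.+1 (fun t => \sum_j f j t * h j t) t0 =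
    derive1n k (fun t => \sum_j B f j t * C h j t) t0.
  move=> sb sc; rewrite derive1Sn; apply: derive1n_eq_on oI It0 _ => u Iu.
  rewrite derive1E.
  have [_ ->] : is_derive u 1 (fun t => \sum_j f j t * h j t)
     (\sum_j (derive1 (f j) u * h j u + f j u * derive1 (h j) u)).
    apply: is_derive_sumr => j.
    have H := is_deriveM (smooth_is_derive1 (sb j) Iu) (smooth_is_derive1 (sc j) Iu).
    refine (@is_derive_eq _ _ _ _ _ _ _ _ H _).
    by rewrite /GRing.scale/= addrC; congr (_ + _); rewrite mulrC.
  rewrite -(pair_bigA _ (fun j e => B f (j, e) u * C h (j, e) u))/=.
  by apply: eq_bigr => j _; rewrite big_bool.
rewrite !step; try by move=> j; have [] := sm j.
apply: IH => j; rewrite /B /C.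
- have [s1 s2 s3 s4] := sm j.1.
  by case: j.2; split => //; exact: smooth_derive1.
- by case: j.2; [exact: contact_derive1|exact: contactS].
- by case: j.2; [exact: contactS|exact: contact_derive1].
Qed.

Lemma contact_mul (R : realType) (I : set R) (t0 : R) k (b c b' c' : R -> R) :
  open I -> I t0 -> smooth I b -> smooth I c -> smooth I b' -> smooth I c' ->
  contact k t0 b b' -> contact k t0 c c' ->
  contact k t0 (fun t => b t * c t) (fun t => b' t * c' t).
Proof.
move=> oI It0 sb sc sb' sc' cb cc l lk.
have E (f h : R -> R) : (fun t => f t * h t) = (fun t => \sum_(j < 1) f t * h t).
  by apply/funext => t; rewrite big_ord1.
rewrite !E; apply: (derive1n_sum_mul_contact oI It0) => _.
- by split.
- by move=> a al; apply: cb; rewrite (leq_trans al).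
- by move=> a al; apply: cc; rewrite (leq_trans al).
Qed.

Lemma sum_option (V : nmodType) (T : finType) (F : option T -> V) :
  \sum_o F o = F None + \sum_i F (Some i).
Proof.
rewrite (bigD1 None)//=; congr (_ + _).
rewrite (reindex_omap Some id)/=; last by case.
by apply: eq_bigl => i; rewrite eqxx.
Qed.

(** * Time-dependent maps at a fixed time *)

Section Slices.
Context {R : realType} {m : nat}.

Definition slice (A : set (R * 'rV[R]_m)) (s : R) := [set x | A (s, x)].

Lemma slice_quotient (f : R * 'rV[R]_m -> R) (s : R) (x v : 'rV[R]_m) :
  (fun h : R => h^-1 *: (((fun x => f (s, x)) \o shift x) (h *: v) - f (s, x))) =
  (fun h : R => h^-1 *: ((f \o shift (s, x)) (h *: ((0, v) : R * 'rV[R]_m)) - f (s, x))).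
Proof.
apply/funext => h /=; congr (_ *: (f _ - _)).
have -> : h *: ((0, v) : R * 'rV[R]_m) + (s, x) = (h *: (0 : R) + s, h *: v + x) by [].
by rewrite scaler0 add0r.
Qed.

Lemma derive_slice (f : R * 'rV[R]_m -> R) (s : R) v :
  'D_v (fun x => f (s, x)) = fun x => 'D_((0, v) : R * 'rV[R]_m) f (s, x).
Proof.
by apply/funext => x; rewrite /derive slice_quotient.
Qed.

Lemma pair_continuousr (s : R) : continuous (fun x : 'rV[R]_m => (s, x)).
Proof.
move=> x P [[P1 P2] /= [n1 n2] sub]; apply: filterS n2 => y P2y.
by apply: sub; split=> //=; exact: nbhs_singleton n1.
Qed.

Lemma Ck_slice k (A : set (R * 'rV[R]_m)) (f : R * 'rV[R]_m -> R) (s : R) :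
  Ck k A f -> Ck k (slice A s) (fun x => f (s, x)).
Proof.
have cs x : {for x, continuous (fun x : 'rV[R]_m => (s, x))} by exact: pair_continuousr.
elim: k f => [|k IH] f Cf.
  split => // x; rewrite inE => Ax.
  by apply: (@continuous_comp _ _ _ (fun x => (s, x)) f x); [|exact: Ck_continuous Cf Ax].
split.
  move=> x; rewrite inE => Ax.
  by apply: (@continuous_comp _ _ _ (fun x => (s, x)) f x); [|exact: Ck_continuous Cf Ax].
move=> v; rewrite derive_slice; split; last exact: (IH _ (Ck_derive (0, v) Cf)).
move=> x; rewrite inE => Ax.
have := Ck_derivable (v := (0, v)) Cf Ax.
by rewrite /derivable -slice_quotient.
Qed.

Lemma slice_open (A : set (R * 'rV[R]_m)) (s : R) : open A -> open (slice A s).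
Proof.
move=> oA; apply: (@open_comp _ _ (fun x : 'rV[R]_m => (s, x))) oA => x _.
exact: pair_continuousr.
Qed.

End Slices.

(** * Higher derivatives of composites: contact and dependence on a parameter *)

Section CurveJets.
Context {R : realType} {m : nat}.
Variables (I : set R) (t0 : R).
Hypotheses (oI : open I) (It0 : I t0).

(* The sums b_j(t) f_j(u(t)) are stable under d/dt: the chain rule indexes the
   new summands by J * option 'I_m. *)
Let B (J : finType) (b : J -> R -> R) (u : R -> 'rV[R]_m) (j : J * option 'I_m) : R -> R :=
  if j.2 is Some i then fun t => b j.1 t * derive1 (fun t => u t 0 i) t
  else derive1 (b j.1).

Let Df (J : finType) (f : J -> 'rV[R]_m -> R) (j : J * option 'I_m) : 'rV[R]_m -> R :=
  if j.2 is Some i then 'D_('e_i) (f j.1) else f j.1.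

Let derive1_sum_comp (A : set 'rV[R]_m) (u : R -> 'rV[R]_m) (J : finType)
    (b : J -> R -> R) (f : J -> 'rV[R]_m -> R) k :
  open A -> smooth I u -> (forall t, I t -> A (u t)) ->
  (forall j, smooth I (b j)) -> (forall j, smooth A (f j)) ->
  derive1n k.+1 (fun t => \sum_j b j t * f j (u t)) t0 =
  derive1n k (fun t => \sum_j B b u j t * Df f j (u t)) t0.
Proof.
move=> oA su uA sb sf; rewrite derive1Sn; apply: derive1n_eq_on oI It0 _ => t It.
rewrite derive1E.
have [_ ->] // : is_derive t 1 (fun t => \sum_j b j t * f j (u t))
   (\sum_j (derive1 (b j) t * f j (u t) +
     \sum_i b j t * derive1 (fun t => u t 0 i) t * 'D_('e_i) (f j) (u t))).
  apply: is_derive_sumr => j.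
  have H := is_deriveM (smooth_is_derive1 (sb j) It)
    (is_derive_curve oA (sf j 1%N) (uA t It) (smooth_is_derive1 su It)).
  refine (@is_derive_eq _ _ _ _ _ _ _ _ H _).
  rewrite /GRing.scale/= addrC; congr (_ + _); first by rewrite mulrC.
  rewrite mulr_sumr; apply: eq_bigr => i _; rewrite mulrA; congr (_ * _ * _).
  have [_] := derive_coord 0 i (Ck_derivable (v := (1 : R)) (su 1%N) It).
  by rewrite !derive1E => ->.
rewrite -(pair_bigA _ (fun j o => B b u (j, o) t * Df f (j, o) (u t)))/=.
by apply: eq_bigr => j _; rewrite sum_option.
Qed.

Let smoothB (J : finType) (b : J -> R -> R) (u : R -> 'rV[R]_m) j :
  smooth I u -> (forall j, smooth I (b j)) -> smooth I (B b u j).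
Proof.
move=> su sb; rewrite /B; case: j.2 => [i|]; last exact: smooth_derive1.
by apply: smoothM => //; apply: smooth_derive1; exact: smooth_coord.
Qed.

Let smoothDf (A : set 'rV[R]_m) (J : finType) (f : J -> 'rV[R]_m -> R) j :
  (forall j, smooth A (f j)) -> smooth A (Df f j).
Proof.
by move=> sf; rewrite /Df; case: j.2 => [i|]; [exact: smooth_derive|exact: sf].
Qed.

(** The k-jet of f(u(t)) depends only on the k-jet of u. The coefficients b_j are there for the
    induction: they collect the derivatives of [u] that the chain rule produces, and replace the
    formula of Faa di Bruno. *)
Lemma derive1n_comp_contact (A : set 'rV[R]_m) (u w : R -> 'rV[R]_m) k :
  open A -> smooth I u -> smooth I w ->
  (forall t, I t -> A (u t)) -> (forall t, I t -> A (w t)) ->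
  (forall i, contact k t0 (fun t => u t 0 i) (fun t => w t 0 i)) ->
  forall (J : finType) (b b' : J -> R -> R) (f : J -> 'rV[R]_m -> R),
  (forall j, smooth I (b j)) -> (forall j, smooth I (b' j)) ->
  (forall j, smooth A (f j)) -> (forall j, contact k t0 (b j) (b' j)) ->
  derive1n k (fun t => \sum_j b j t * f j (u t)) t0 =
  derive1n k (fun t => \sum_j b' j t * f j (w t)) t0.
Proof.
move=> oA su sw uA wA; elim: k => [|k IH] cuw J b b' f sb sb' sf cb.
  have E : u t0 = w t0 by apply/rowP => i; exact: (cuw i 0%N).
  by apply: eq_bigr => j _; rewrite E; congr (_ * _); exact: (cb j 0%N).
rewrite (derive1_sum_comp k oA su uA)// (derive1_sum_comp k oA sw wA)//.
apply: IH => [i|j|j|j|[j [i|]]].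
- exact: contactS.
- exact: smoothB.
- exact: smoothB.
- exact: smoothDf.
- apply: (contact_mul oI It0) => //.
  + by apply: smooth_derive1; exact: smooth_coord.
  + by apply: smooth_derive1; exact: smooth_coord.
  + exact: contactS.
  + exact: contact_derive1.
- exact: contact_derive1.
Qed.

(** One d/dt stays in the class of sums and lowers [k], so that only the case [k = 0] differentiates
    in [s]. The step needs d/ds to commute with the spatial partial derivatives of f_j, which is
    [derive_symmetric]. *)
Lemma derive1n_param (A : set (R * 'rV[R]_m)) (u : R -> 'rV[R]_m) (e : R) k :
  open A -> smooth I u -> 0 < e -> (forall s t, `|s| < e -> I t -> A (s, u t)) ->
  forall (J : finType) (b : J -> R -> R) (f : J -> R * 'rV[R]_m -> R),
  (forall j, smooth I (b j)) -> (forall j, smooth A (f j)) ->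
  is_derive (0 : R) 1 (fun s => derive1n k (fun t => \sum_j b j t * f j (s, u t)) t0)
    (derive1n k (fun t => \sum_j b j t * 'D_((1, 0) : R * 'rV[R]_m) (f j) (0, u t)) t0).
Proof.
move=> oA su e0 uA; elim: k => [|k IH] J b f sb sf.
  apply: is_derive_sumr => j; apply: is_deriveZ.
  have A0 : A (0, u t0) by apply: uA; rewrite ?normr0.
  have := @is_derive_line _ _ _ (f j) (0, u t0) (1, 0) 0.
  rewrite scale0r addr0 => /(_ (Ck_derivable (sf j 1%N) A0)).
  have -> // : (fun s : R => f j ((0, u t0) + s *: ((1, 0) : R * 'rV[R]_m))) =
    (fun s => f j (s, u t0)).
  apply/funext => s; congr (f j _).
  have -> : (0, u t0) + s *: ((1, 0) : R * 'rV[R]_m) =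
    (0 + s *: (1 : R), u t0 + s *: 0) by [].
  by rewrite add0r scaler0 addr0 [s *: 1]mulr1.
pose Df2 (j : J * option 'I_m) : R * 'rV[R]_m -> R :=
  if j.2 is Some i then 'D_((0, 'e_i) : R * 'rV[R]_m) (f j.1) else f j.1.
have sDf2 j : smooth A (Df2 j).
  by rewrite /Df2; case: j.2 => [i|]; [exact: smooth_derive|exact: sf].
have := IH _ (B b u) Df2 (fun j => smoothB j su sb) sDf2.
have -> : derive1n k (fun t => \sum_j B b u j t * 'D_((1, 0) : R * 'rV[R]_m) (Df2 j) (0, u t)) t0
  = derive1n k.+1 (fun t => \sum_j b j t * 'D_((1, 0) : R * 'rV[R]_m) (f j) (0, u t)) t0.
  rewrite (derive1_sum_comp (A := slice A 0) k (f := fun j x => 'D_((1, 0) : R * 'rV[R]_m) (f j) (0, x)))//.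
  - apply: derive1n_eq_on oI It0 _ => t It; apply: eq_bigr => j _; congr (_ * _).
    rewrite /Df2 /Df; case: j.2 => [i|//].
    have E := derive_slice ('D_((1, 0) : R * 'rV[R]_m) (f j.1)) 0 'e_i.
    apply: etrans (esym (congr1 (@^~ (u t)) E)).
    apply: (derive_symmetric _ _ oA (sf j.1 2%N)).
    by apply: uA; rewrite ?normr0.
  - exact: slice_open.
  - by move=> t It; apply: uA; rewrite ?normr0.
  - move=> j l; have H := Ck_derive ((1, 0) : R * 'rV[R]_m) (sf j l.+1).
    exact: (Ck_slice 0 H).
have nse : \forall s \near (0 : R), `|s| < e.
  by apply/nbhs_ballP; exists e => // s; rewrite -ball_normE/= sub0r normrN.
apply: near_eq_is_derive; apply: filterS nse => s se.
rewrite (derive1_sum_comp (A := slice A s) k (f := fun j x => f j (s, x)))//.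
- congr (derive1n k _ t0); apply/funext => t; apply: eq_bigr => j _; congr (_ * _).
  rewrite /Df2 /Df; case: j.2 => [i|//].
  have E := derive_slice (f j.1) s 'e_i.
  by have /= := congr1 (@^~ (u t)) E.
- exact: slice_open.
- by move=> t It; exact: uA.
- by move=> j l; exact: (Ck_slice s (sf j l)).
Qed.

End CurveJets.

(** * Jets and flows *)

Lemma derive_pair (R : realType) (U W : normedModType R) (f : R -> U) (h : R -> W)
  (t : R) df dh : is_derive t 1 f df -> is_derive t 1 h dh ->
  'D_1 (fun t => (f t, h t)) t = (df, dh).
Proof.
move=> [/derivable1_diffP f' <-] [/derivable1_diffP h' <-].
by rewrite deriveE ?diff_pair//; [rewrite !deriveE|exact: differentiable_pair].
Qed.

Lemma is_derive_mx (R : realType) (p q : nat) (F : R -> 'M[R]_(p, q)) (t : R) (D : 'M[R]_(p, q)) :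
  (forall i j, is_derive t 1 (fun u => F u i j) (D i j)) -> is_derive t 1 F D.
Proof.
move=> FD; have dF : derivable F t 1 by apply/derivable_mxP => i j; case: (FD i j).
split => //; apply/matrixP => i j.
by have [_ <-] := derive_coord i j dF; case: (FD i j).
Qed.

Section FlowJets.
Context {R : realType} {m : nat} {M : manifold R m}.
Variables (X : vector_field M) (phi : R -> M -> M).
Hypothesis flowX : is_flow X phi.
Implicit Types (c d : chart R m M) (s w : R -> M).

Definition flow_dom c d : set (R * 'rV[R]_m) :=
  [set z | ccod c z.2 /\ cdom d (phi z.1 (cinv c z.2))].

Definition flow_map c d (z : R * 'rV[R]_m) : 'rV[R]_m :=
  crd d (phi z.1 (cinv c z.2)).

Let phi_continuous p (tau : R) : phi u.1 u.2 @[u --> (tau, p)] --> phi tau p.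
Proof. by have [_ _ /(_ (tau, p))] := flowX. Qed.

Let phi_tau_continuous (tau : R) : continuous (phi tau).
Proof.
move=> p P /(phi_continuous (p := p)) [[P1 P2] /= [n1 n2] sub].
apply: filterS n2 => y P2y; apply: (sub (tau, y)).
by split => //=; exact: nbhs_singleton n1.
Qed.

Let flow_map_smooth c d : atlas c -> atlas d -> smooth (flow_dom c d) (flow_map c d).
Proof. by move=> ac ad; have [_ _ _ sm _] := flowX; exact: sm. Qed.

Let flow_dom_open c d : atlas c -> atlas d -> open (flow_dom c d).
Proof.
move=> ac ad; rewrite openE => -[tau x] [/= cx dx].
have nd : nbhs (phi tau (cinv c x)) (cdom d).
  by apply: open_nbhs_nbhs; split; [exact: cdom_open|].
have [[P1 P2] /= [n1 n2] sub] := phi_continuous nd.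
have n2' : \forall y \near x, P2 (cinv c y) by exact: cinv_continuous n2.
have nc : \forall y \near x, ccod c y.
  by apply: open_nbhs_nbhs; split; [exact: ccod_open|].
exists (P1, [set y | ccod c y /\ P2 (cinv c y)]); first by split => //=; exact: filterI.
by move=> [t y] /= [P1t [cy P2y]]; split => //; exact: (sub (t, cinv c y)).
Qed.

Lemma smooth_curve_chart (J : set R) s c : atlas c -> smooth_curve J s ->
  open (J `&` s @^-1` cdom c).
Proof.
move=> ac [oJ cs _]; rewrite openE => t [Jt ct]; apply: filterI.
  exact: open_nbhs_nbhs.
apply: cs; first by rewrite inE.
by apply: open_nbhs_nbhs; split => //; exact: cdom_open.
Qed.

Lemma flow_curve_chart (J : set R) s c d (tau t0 : R) : smooth_curve J s -> J t0 ->
  atlas c -> atlas d -> cdom c (s t0) -> cdom d (phi tau (s t0)) ->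
  exists I, [/\ open I, I t0, I `<=` J `&` s @^-1` cdom c, smooth I (crd c \o s) &
    forall t, I t -> slice (flow_dom c d) tau (crd c (s t)) /\
      crd d (phi tau (s t)) = flow_map c d (tau, crd c (s t))].
Proof.
move=> sJ Jt0 ac ad ct0 dt0.
have oA := smooth_curve_chart ac sJ; have [oJ cs ss] := sJ.
pose I := J `&` s @^-1` cdom c `&` (phi tau \o s) @^-1` cdom d.
have sub : I `<=` J `&` s @^-1` cdom c by move=> t [].
exists I; split => //.
- rewrite openE => t [[Jt ct] dt]; apply: filterI.
    by apply: open_nbhs_nbhs; split.
  have cps : {for t, continuous (phi tau \o s)}.
    by apply: continuous_comp; [apply: cs; rewrite inE|exact: phi_tau_continuous].
  by apply: cps; apply: open_nbhs_nbhs; split; [exact: cdom_open|].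
- by move=> k; apply: Ck_subset sub _; exact: ss.
- move=> t [[Jt ct] dt]; rewrite /slice /flow_map /= crdK//; split => //.
  by split => /=; [exact: ccod_crd|rewrite crdK].
Qed.

Lemma flow_smooth_curve (J : set R) s (tau : R) :
  smooth_curve J s -> smooth_curve J (phi tau \o s).
Proof.
move=> sJ; have [oJ cs ss] := sJ.
have cps : {in J, continuous (phi tau \o s)}.
  move=> t Jt; apply: continuous_comp; [exact: cs|exact: phi_tau_continuous].
split => // d ad k; apply: Ck_local => t [Jt dt].
have [c ac ct] := atlas_cover (s t).
have [I [oI It IJ sI Ieq]] := flow_curve_chart sJ Jt ac ad ct dt.
exists I; split => //; apply/(Ck_mxP k _ oI) => i j.
have sl : smooth (slice (flow_dom c d) tau) (fun x => flow_map c d (tau, x) i j).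
  move=> l; apply: (Ck_slice (f := fun z => flow_map c d z i j)).
  exact: smooth_coord (flow_dom_open ac ad) (flow_map_smooth ac ad) l.
have C := smooth_comp_curve (slice_open (s := tau) (flow_dom_open ac ad)) oI sl sI
  (fun u Iu => (Ieq u Iu).1) k.
by apply: Ck_eq oI _ C => u; rewrite inE => /Ieq[_ /= ->].
Qed.

(** This makes [jet_map] independent of the representative. A single chart is enough, since
    [phi tau (s t0)] remains in the domain of [c] for small [tau]. *)
Lemma flow_contact r c s w (t0 tau : R) : atlas c -> cdom c (s t0) ->
  cdom c (phi tau (s t0)) -> smooth_at t0 s -> smooth_at t0 w -> w t0 = s t0 ->
  (forall k, (k <= r)%N -> crd_derive c w k t0 = crd_derive c s k t0) ->
  forall k, (k <= r)%N -> crd_derive c (phi tau \o w) k t0 = crd_derive c (phi tau \o s) k t0.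
Proof.
move=> ac cs cps [Js Jst sJ] [Jw Jwt wJ] wst ws k kr.
have [I1 [oI1 I1t _ sI1 I1eq]] := flow_curve_chart sJ Jst ac ac cs cps.
rewrite -wst in cs cps.
have [I2 [oI2 I2t _ sI2 I2eq]] := flow_curve_chart wJ Jwt ac ac cs cps.
pose I := I1 `&` I2; have oI : open I by exact: openI.
have It : I t0 by [].
have ss : smooth I (crd c \o s) by move=> l; apply: Ck_subset (sI1 l) => t [].
have sw : smooth I (crd c \o w) by move=> l; apply: Ck_subset (sI2 l) => t [].
have sps (J : set R) v : smooth_curve J v -> J t0 -> cdom c (phi tau (v t0)) ->
    exists I', [/\ open I', I' t0 & smooth I' (crd c \o (phi tau \o v))].
  move=> vJ Jt cv; exists (J `&` (phi tau \o v) @^-1` cdom c); split => //.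
    exact: smooth_curve_chart (flow_smooth_curve tau vJ).
  by have [_ _ /(_ c ac)] := flow_smooth_curve tau vJ.
have [I3 [oI3 I3t sI3]] := sps _ _ wJ Jwt cps.
rewrite wst in cps; have [I4 [oI4 I4t sI4]] := sps _ _ sJ Jst cps.
apply/rowP => i.
rewrite /crd_derive (derive1n_coord k 0 i oI3 sI3 I3t) (derive1n_coord k 0 i oI4 sI4 I4t).
have D (v : R -> M) :
    (forall t, I t -> crd c (phi tau (v t)) = flow_map c c (tau, crd c (v t))) ->
    derive1n k (fun t => (crd c \o (phi tau \o v)) t 0 i) t0 =
    derive1n k (fun t => \sum_(j < 1) cst (1 : R) t * flow_map c c (tau, (crd c \o v) t) 0 i) t0.
  move=> vE; apply: derive1n_eq_on oI It _ => t It'.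
  by rewrite big_ord1 mul1r /= vE.
rewrite !D; [|by move=> t [/I1eq[]]|by move=> t [_ /I2eq[]]].
apply: (@derive1n_comp_contact R m I t0 oI It (slice (flow_dom c c) tau)
  (crd c \o w) (crd c \o s) k (slice_open (s := tau) (flow_dom_open ac ac)) sw ss _ _ _
  'I_1 (fun=> cst 1) (fun=> cst 1) (fun _ x => flow_map c c (tau, x) 0 i)).
- by move=> t [_ /I2eq[]].
- by move=> t [/I1eq[]].
- move=> a l lk.
  rewrite -(derive1n_coord l 0 a oI sw It) -(derive1n_coord l 0 a oI ss It).
  by have := ws l (leq_trans lk kr); rewrite /crd_derive => ->.
- by move=> _ l; exact: Ck_cst.
- by move=> _ l; exact: Ck_cst.
- move=> _ l; apply: (Ck_slice (f := fun z => flow_map c c z 0 i)).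
  exact: smooth_coord (flow_dom_open ac ac) (flow_map_smooth ac ac) l.
- by [].
Qed.

(** [jet_crd] chooses an element of a set: the set is nonempty because the jet of [phi tau \o s]
    contains that curve, and by [flow_contact] every choice has the same coordinates. *)
Lemma jet_crd_flow r c s (t0 tau : R) : atlas c -> cdom c (s t0) ->
  cdom c (phi tau (s t0)) -> smooth_at t0 s ->
  jet_crd r c (jet_map r (phi tau) (jet r t0 s)) =
  (t0, \matrix_(k < r.+1) crd_derive c (phi tau \o s) k t0).
Proof.
move=> ac cs cps st0; rewrite /jet_crd.
set S := [set _ | _ in _].
have nS : exists z, S z.
  exists (t0, \matrix_(k < r.+1) crd_derive c (phi tau \o s) k t0).
  exists (t0, phi tau \o s) => //; exists (t0, s); first by split.
  split => //; have [J Jt sJ] := st0; exists J => //; exact: flow_smooth_curve.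
have := getPex nS => -[w' [w [wt0 ww ws wsk] [w't w'w w's w'sk]] <-].
rewrite w't wt0; congr pair; apply/row_matrixP => k.
rewrite !rowK; rewrite wt0 in w's w'sk.
rewrite w'sk//; last 2 first.
- by rewrite /= ws.
- by rewrite -ltnS.
by apply: (@flow_contact r) => // [l lr|]; [exact: wsk|rewrite -ltnS].
Qed.

(** In coordinates the prolonged field at the jet is 0 for the parameter, followed by the
    t-derivatives of X(s(t)): [X] is the tau-derivative of the flow at 0, and d/dtau commutes with
    the derivatives in t. *)
Lemma prolongation_eq0 r c s (t0 : R) : atlas c -> cdom c (s t0) -> smooth_at t0 s ->
  prolongation r phi c (jet r t0 s) = 0 ->
  forall k i, (k <= r)%N -> derive1n k (fun t => X c (cinv c (crd c (s t))) 0 i) t0 = 0.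
Proof.
move=> ac cs st0; have [J Jt sJ] := st0 => prol0.
have [phi0 _ _ _ phiD] := flowX.
pose u := crd c \o s.
have [I0 [oI0 I0t I0J sI0 _]] := flow_curve_chart (tau := 0) sJ Jt ac ac cs
  (eq_ind_r (cdom c) cs (phi0 (s t0))).
have n0 : nbhs ((0, u t0) : R * 'rV[R]_m) (flow_dom c c).
  apply: open_nbhs_nbhs; split; first exact: flow_dom_open.
  by split; [exact: ccod_crd|rewrite /= phi0 /u /= crdK].
(* A product neighbourhood inside the flow domain yields one [e] and one [I] valid for all
   [|tau| < e] and [t] in [I] at once, as [derive1n_param] requires. *)
have [[P1 P2] /= [n1 n2] sub] := n0.
have [e /= e0 Be] : nbhs_ball (0 : R) P1 by rewrite nbhs_ballE.
pose I := (I0 `&` u @^-1` P2)°.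
have oI : open I by exact: open_interior.
have It : I t0.
  apply: filterI; first by apply: open_nbhs_nbhs.
  exact: (Ck_continuous (sI0 0%N) I0t) n2.
have sI : smooth I u by move=> l; apply: Ck_subset (sI0 l) => t /interior_subset[].
have uA tau t : `|tau| < e -> I t -> flow_dom c c (tau, u t).
  move=> te /interior_subset[_ /= P2u]; apply: (sub (tau, u t)); split => //=.
  by apply: Be; rewrite -ball_normE/= sub0r normrN.
have Ic t : I t -> cdom c (s t) by move=> /interior_subset[/I0J[]].
pose f (i : 'I_m) (_ : 'I_1) (z : R * 'rV[R]_m) := flow_map c c z 0 i.
(* The one-term sums with coefficient 1 only give the entries the shape of [derive1n_param]. *)
pose N tau : 'M[R]_(r.+1, m) := \matrix_(k, i)
  derive1n k (fun t => \sum_(j < 1) cst (1 : R) t * f i j (tau, u t)) t0.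
pose D : 'M[R]_(r.+1, m) := \matrix_(k, i)
  derive1n k (fun t => X c (cinv c (u t)) 0 i) t0.
have XE (i : 'I_m) x : ccod c x ->
    'D_((1, 0) : R * 'rV[R]_m) (fun z => flow_map c c z 0 i) (0, x) = X c (cinv c x) 0 i.
  move=> cx; have [cpx _] := cinvP ac cx.
  have cp0 : cdom c (phi 0 (cinv c x)) by rewrite phi0.
  have [d1 dE] := phiD c 0 (cinv c x) ac cp0.
  have [|_ ->] // := @is_derive_of_line R _ _ (fun z => flow_map c c z 0 i) (0, x) (1, 0)
    (X c (cinv c x) 0 i).
  have -> : (fun tau : R => flow_map c c ((0, x) + tau *: ((1, 0) : R * 'rV[R]_m)) 0 i) =
      (fun tau => crd c (phi tau (cinv c x)) 0 i).
    apply/funext => tau; rewrite /flow_map.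
    have -> : (0, x) + tau *: ((1, 0) : R * 'rV[R]_m) = (0 + tau *: (1 : R), x + tau *: 0) by [].
    by rewrite /= add0r scaler0 addr0 [tau *: 1]mulr1.
  by have := derive_coord 0 i d1; rewrite dE phi0.
have ND : is_derive (0 : R) 1 N D.
  apply: is_derive_mx => k i; rewrite mxE.
  have -> : (fun tau => N tau k i) = (fun tau =>
      derive1n k (fun t => \sum_(j < 1) cst (1 : R) t * f i j (tau, u t)) t0).
    by apply/funext => tau; rewrite mxE.
  have sf j : smooth (flow_dom c c) (f i j).
    exact: smooth_coord (flow_dom_open ac ac) (flow_map_smooth ac ac).
  have := @derive1n_param R m I t0 oI It _ u e k (flow_dom_open ac ac) sI e0 uA
    'I_1 (fun=> cst 1) (f i) (fun _ l => Ck_cst l I (1 : R)) sf.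
  congr (is_derive _ _ _ _); apply: derive1n_eq_on oI It _ => t It'.
  by rewrite big_ord1 mul1r /f XE//; apply: ccod_crd; exact: Ic.
have prolE : prolongation r phi c (jet r t0 s) = (0, D).
  rewrite /prolongation derive1E -(derive_pair (is_derive_cst t0 (0 : R) 1) ND).
  apply/esym/near_eq_derive.
  have nse : \forall tau \near (0 : R), `|tau| < e.
    by apply/nbhs_ballP; exists e => // tau; rewrite -ball_normE/= sub0r normrN.
  apply: filterS nse => tau te.
  have [_ cps] := uA tau t0 te It; rewrite /u /= crdK// in cps.
  rewrite jet_crd_flow//; congr pair; apply/matrixP => k i; rewrite !mxE.
  have [I3 [oI3 I3t sI3]] : exists I', [/\ open I', I' t0 & smooth I' (crd c \o (phi tau \o s))].
    exists (J `&` (phi tau \o s) @^-1` cdom c); split => //.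
      exact: smooth_curve_chart (flow_smooth_curve tau sJ).
    by have [_ _ /(_ c ac)] := flow_smooth_curve tau sJ.
  rewrite /crd_derive (derive1n_coord k 0 i oI3 sI3 I3t).
  apply: derive1n_eq_on oI It _ => t It'.
  by rewrite big_ord1 mul1r /f /flow_map /u /= crdK//; exact: Ic.
move: prol0; rewrite prolE => -[D0] k i kr.
have := congr1 (fun D : 'M[R]_(r.+1, m) => D (Ordinal (kr : (k < r.+1)%N)) i) D0.
by rewrite !mxE.
Qed.

End FlowJets.

(** * Killing fields vanishing on an open set *)

Section KillingManifold.
Context {R : realType} {m : nat} {M : manifold R m}.
Variables (g : riemannian_metric M) (X : vector_field M).
Hypothesis killX : killing g X.
Implicit Types (c d : chart R m M) (p q : M).

Lemma vector_field_eq0 c d q : atlas c -> atlas d -> cdom c q -> cdom d q ->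
  X c q = 0 -> X d q = 0.
Proof.
by move=> ac ad cq dq X0; rewrite (vcomp_tangent X ac ad cq dq) X0 derive0.
Qed.

Lemma killing_chart c x : atlas c -> ccod c x -> forall i j,
  \sum_k ((X c \o cinv c) x 0 k * 'D_('e_k) (fun y => chart_metric g c y i j) x
          + chart_metric g c x k j * 'D_('e_i) (fun y => (X c \o cinv c) y 0 k) x
          + chart_metric g c x i k * 'D_('e_j) (fun y => (X c \o cinv c) y 0 k) x) = 0.
Proof. by move=> ac cx i j; apply: (killX ac); rewrite inE. Qed.

Let zero_set : set M := [set q | forall d, atlas d -> cdom d q -> X d q = 0].

Lemma near_zero_set c q : atlas c -> cdom c q ->
  (\forall y \near crd c q, (X c \o cinv c) y = 0) -> zero_set° q.
Proof.
move=> ac cq n0.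
have n1 : \forall p \near q, X c (cinv c (crd c p)) = 0.
  exact: (crd_continuous ac cq) n0.
have n2 : \forall p \near q, cdom c p.
  by apply: open_nbhs_nbhs; split; [exact: cdom_open|].
apply: filterS2 n1 n2 => p Xp cp d ad dp.
by apply: (vector_field_eq0 ac ad cp dp); rewrite -{1}(crdK ac cp).
Qed.

Let zero_set_chart c q : atlas c -> cdom c q -> zero_set° q ->
  \forall y \near crd c q, (X c \o cinv c) y = 0.
Proof.
move=> ac cq zq.
have cc := ccod_crd cq.
have n1 : \forall y \near crd c q, zero_set (cinv c y).
  by apply: (cinv_continuous ac cc); rewrite crdK.
have n2 : \forall y \near crd c q, ccod c y.
  by apply: open_nbhs_nbhs; split; [exact: ccod_open|].
by apply: filterS2 n1 n2 => y zy cy /=; apply: zy => //; exact: (cinvP ac cy).1.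
Qed.

(** At a limit point, the field and its first partial derivatives vanish by continuity, so
    [killing_near0] applies at that point itself. *)
Let zero_set_closed : closed (zero_set°).
Proof.
move=> q clq; have [c ac cq] := atlas_cover q.
have cc := ccod_crd cq; have oc := ccod_open ac.
have sX := vcomp_smooth X ac.
(* Used for the components of the field and for their partial derivatives; [eq_at_limit] compares
   [h] at nearby points of the interior with the constant 0. *)
have limit0 (h : 'rV[R]_m -> R) : {for crd c q, continuous h} ->
    (forall y, (\forall z \near y, (X c \o cinv c) z = 0) -> h y = 0) -> h (crd c q) = 0.
  move=> ch h0.
  have nA : nbhs (crd c q) (ccod c) by apply: open_nbhs_nbhs; split.
  apply: (@eq_at_limit R _ (ccod c) h (cst 0) _ nA ch (@cst_continuous _ _ 0 _)) => r r0 _.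
  have nq : nbhs q (cdom c `&` crd c @^-1` ball (crd c q) r).
    apply: filterI; first by apply: open_nbhs_nbhs; split; [exact: cdom_open|].
    by apply: (crd_continuous ac cq); exact: nbhsx_ballx.
  have [p [zp [cp pr]]] := clq _ nq.
  exists (crd c p) => //; exists (crd c q); first exact: ballxx.
  by rewrite h0//; exact: zero_set_chart.
have sXl k l : Ck k (ccod c) (fun y => (X c \o cinv c) y 0 l).
  exact: (Ck_mxP k _ oc).1 (sX k) 0 l.
apply: (near_zero_set ac cq).
apply: (killing_near0 oc (chart_metric_smooth g ac) sX
  (fun x => @chart_metric_sym _ _ _ g c x ac) (fun x => @chart_metric_pos _ _ _ g c x ac)
  (fun x => @killing_chart c x ac) cc).
  apply/rowP => l; rewrite [RHS]mxE.
  apply: (limit0 (fun y => (X c \o cinv c) y 0 l)).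
    exact: Ck_continuous (sXl 0%N l) cc.
  by move=> y /nbhs_singleton ->; rewrite mxE.
move=> i l; apply: (limit0 ('D_('e_i) (fun y => (X c \o cinv c) y 0 l))).
  exact: Ck_continuous (Ck_derive _ (sXl 1%N l)) cc.
move=> y n0; rewrite -(derive_cst (0 : R) y 'e_i); apply: near_eq_derive.
by apply: filterS n0 => z /= ->; rewrite mxE.
Qed.

Lemma killing_eq0 c p : connected [set: M] -> atlas c -> cdom c p ->
  (\forall y \near crd c p, (X c \o cinv c) y = 0) -> is_zero_field X.
Proof.
move=> connM ac cp n0 d q ad dq.
have ZT : zero_set° = setT.
  apply: connM; first by exists p; exact: near_zero_set n0.
    by exists (zero_set°); [exact: open_interior|rewrite setTI].
  by exists (zero_set°); [exact: zero_set_closed|rewrite setTI].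
have : zero_set° q by rewrite ZT.
by move=> /interior_subset; apply.
Qed.

End KillingManifold.

(** * Vanishing of the differential of X at the base point of the jet *)

Theorem theorem5p4 (R : realType) (m : nat) (M : manifold R m)
  (g : riemannian_metric M) (a b : \bar R) (t0 : R) (sigma : R -> M)
  (X : vector_field M) (phi : R -> M -> M) :
  (0 < m)%N ->
  connected [set: M] ->
  complete_metric g ->
  smooth_curve [set t : R | (a < t%:E < b)%E] sigma ->
  (a < t0%:E < b)%E ->
  normal_jets g m.-1 (jet m.-1 t0 sigma) ->
  killing g X ->
  is_flow X phi ->
  (forall c : chart R m M, atlas c -> cdom c (sigma t0) ->
     prolongation m.-1 phi c (jet m.-1 t0 sigma) = 0) ->
  is_zero_field X.
Proof.
move=> m0 connM _ sJ Jt0 [t [s [_ [c nc rfree] jE]]] killX flowX prol0.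
have st0 : smooth_at t0 sigma by exists [set t : R | (a < t%:E < b)%E].
(* A jet contains its own representative. Equality of the jets thus gives [t = t0] and the same
   derivatives of [sigma] and [s] up to order m - 1 in every chart, so general position passes from
   [s] to [sigma]. *)
have : jet m.-1 t0 sigma (t0, sigma) by split.
rewrite jE => -[/= tE _ sE dE].
have [ac cst c0 _] := nc; rewrite -tE in cst c0 nc rfree sE dE; clear jE.
rewrite -sE in cst c0 nc dE.
set u := crd c \o sigma.
pose xi := X c \o cinv c.
have jet0 := prolongation_eq0 flowX ac cst st0 (prol0 c ac cst).
have c00 : ccod c 0 by rewrite -c0; exact: ccod_crd.
have xi0 : xi 0 = 0.
  by apply/rowP => i; rewrite mxE -(jet0 0%N i (leq0n _)) /= c0.
pose L : 'M[R]_m := \matrix_(i, l) 'D_('e_i) (fun z => xi z 0 l) 0.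
have oc := ccod_open ac.
have nL : \forall y \near (0 : 'rV[R]_m), xi y = y *m L.
  exact: (killing_linear_near0 oc (chart_metric_smooth g ac) (vcomp_smooth X ac)
    (fun x => @chart_metric_sym _ _ _ g c x ac) (fun x => @chart_metric_pos _ _ _ g c x ac)
    (fun x => killing_chart killX ac) c00 xi0 (normal_chart_christoffel nc)).
have Gu := posdef_unitmx (chart_metric_pos g ac c00).
have GT := chart_metric_sym g ac c00.
set G0 := chart_metric g c 0 in Gu GT.
(* As [xi 0 = 0], the term differentiating the metric drops out of Killing's equation. Skewness
   holds for [L *m G0]; invertibility of [G0] later gives [L] itself. *)
have skew : (L *m G0)^T = - (L *m G0).
  apply/matrixP => i j; rewrite !mxE; apply/eqP; rewrite -addr_eq0; apply/eqP.
  have := killing_chart killX ac c00 i j; rewrite -/xi xi0 => E.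
  rewrite -[RHS]E -big_split/=; apply: eq_bigr => k _; rewrite !mxE mul0r add0r.
  rewrite -[G0 k i](congr1 (fun A : 'M[R]_m => A k i) GT) mxE.
  by rewrite addrC; congr (_ + _); rewrite mulrC.
have sI := smooth_curve_chart ac sJ.
pose U : 'M[R]_(m.-1, m) := \matrix_(k < m.-1) crd_derive c sigma k.+1 t0.
have rU : row_free U.
  have -> : U = \matrix_(k < m.-1) crd_derive c s k.+1 t0; last exact: rfree.
  apply/matrixP => k j; rewrite [LHS]mxE [RHS]mxE.
  exact: (congr1 (fun v : 'rV[R]_m => v 0 j) (dE c k.+1 ac cst (ltn_ord k))).
(* Row [k] is the derivative of order k + 1 <= m - 1 of xi(u(t)), which equals u(t) L near [t0];
   order 0 gave [xi0]. *)
have UL : U *m L = 0.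
  apply/matrixP => k i; rewrite [LHS]mxE [RHS]mxE.
  pose I := [set t : R | (a < t%:E < b)%E] `&` sigma @^-1` cdom c.
  have oI : open I by exact: sI.
  have sIu : smooth I u by have [_ _ /(_ c ac)] := sJ.
  have It : I t0 by split.
  apply: etrans (jet0 k.+1 i (ltn_ord k)); apply/esym.
  have E1 : derive1n k.+1 (fun t => X c (cinv c (crd c (sigma t))) 0 i) t0 =
      derive1n k.+1 (fun t => \sum_j u t 0 j * L j i) t0.
    apply: derive1n_near_eq.
    have cu : {for t0, continuous u} by exact: Ck_continuous (sIu 0%N) It.
    have nL' : \forall y \near u t0, xi y = y *m L by rewrite /u /= c0.
    have nuL : \forall w \near t0, xi (u w) = u w *m L by exact: cu nL'.
    apply: filterS nuL => w ew; rewrite -/u.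
    have -> : X c (cinv c (crd c (sigma w))) = u w *m L := ew.
    by rewrite mxE.
  apply: etrans E1 _.
  rewrite (derive1n_linear (fun j => L j i) k.+1 oI (fun j => smooth_coord 0 j oI sIu) It).
  apply: eq_bigr => j _; congr (_ * _); rewrite [RHS]mxE.
  exact: esym (derive1n_coord k.+1 0 j oI sIu It).
have N0 : L *m G0 = 0.
  by apply: (skew_rank1_eq0 m0 skew rU); rewrite mulmxA UL mul0mx.
have L0 : L = 0 by rewrite -[L](mulmxK Gu) N0 mul0mx.
apply: (killing_eq0 killX connM ac cst); rewrite c0.
by apply: filterS nL => y; rewrite L0 mulmx0.
Qed.
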